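(* Suppose $\mathcal{A}$ is linearly independent. Let $F\subseteq I$ be a homogeneous Gröbner basis of $I$ with respect to a weight vector $\omega_1$ on $\mathbb{K}[x]$, and let $G\subseteq J$ be a homogeneous Gröbner basis of $J$ with respect to a weight vector $\omega_2$ on $\mathbb{K}[y]$. Then $\mathrm{Lift}(F)\cup\mathrm{Lift}(G)\cup\mathrm{Quad}_B$ is a pseudo-Gröbner basis of $I\times_{\mathcal{A}}J$ with respect to the weight vector $\phi_B^*(\omega_1,\omega_2)$.
   Context: Setup: $\mathbb{K}$ a field, $r\ge1$, $s,t\in\mathbb{Z}_{>0}^r$; $\mathbb{K}[x]=\mathbb{K}[x^i_j: i\in[r],j\in[s_i]]$, $\mathbb{K}[y]=\mathbb{K}[y^i_k:i\in[r],k\in[t_i]]$ multigraded by $\deg x^i_j=\deg y^i_k=\mathbf{a}^i\in\mathbb{Z}^d$, $\mathcal{A}=\{\mathbf{a}^1,\dots,\mathbf{a}^r\}$, with some $\omega\in\mathbb{Q}^d$ satisfying $\omega^T\mathbf{a}^i=1$ for all $i$. $I\subseteq\mathbb{K}[x]$, $J\subseteq\mathbb{K}[y]$ are homogeneous ideals for this multigrading. $\mathbb{K}[z]=\mathbb{K}[z^i_{jk}:i\in[r],j\in[s_i],k\in[t_i]]$; the toric fiber product $I\times_{\mathcal{A}}J$ is the kernel of $\mathbb{K}[z]\to\mathbb{K}[x]/I\otimes_{\mathbb{K}}\mathbb{K}[y]/J$, $z^i_{jk}\mapsto x^i_j\otimes y^i_k$. $\phi_B:\mathbb{K}[z]\to\mathbb{K}[x,y]$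 is the monomial map $z^i_{jk}\mapsto x^i_jy^i_k$ with exponent matrix $B$, and for a weight vector $\nu$ on $\mathbb{K}[x,y]$ the pullback weight is $\phi_B^*\nu=\nu^TB$ (the weight of $z^i_{jk}$ is $\nu(x^i_j)+\nu(y^i_k)$); $(\omega_1,\omega_2)$ is the concatenated weight on $\mathbb{K}[x,y]$. $\mathrm{Quad}_B=\{z^i_{j_1k_2}z^i_{j_2k_1}-z^i_{j_1k_1}z^i_{j_2k_2}: i\in[r],1\le j_1<j_2\le s_i,1\le k_1<k_2\le t_i\}$. Weights: for a weight vector $\nu$, $\mathrm{in}_\nu(f)$ is the sum of the terms of $f$ of maximal $\nu$-weight and $\mathrm{in}_\nu(I)=\langle\mathrm{in}_\nu(f):f\in I\rangle$. A finite set $G\subseteq I$ is a pseudo-Gröbner basis of $I$ with respect to $\nu$ if $\langle\mathrm{in}_\nu(g):g\in G\rangle=\mathrm{in}_\nu(I)$, and a Gröbner basis with respect to $\nu$ if additionally this ideal is a monomial ideal. Lifts (for $\mathcal{A}$ linearly independent): a homogeneous $f\in I$ of degree $d$ can be written (after reordering the factors of each monomial) as $f=\sum_{u=1}^v c_u\,x^{i_1}_{j^u_1}x^{i_2}_{j^u_2}\cdots x^{i_d}_{j^u_d}$ with the same sequence of upper indices $i_1,\dots,i_d$ for every term. For $k=(k_1,\dots,k_d)\in T_f:=\prod_{l=1}^d[t_{i_l}]$ put $f_k=\sum_u c_u\,z^{i_1}_{j^u_1k_1}\cdots z^{i_d}_{j^u_dk_d}$, and $\mathrm{Lift}(F)=\{f_k: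 f\in F,\ k\in T_f\}$. Analogously, for homogeneous $g=\sum_u c_u\,y^{i_1}_{k^u_1}\cdots y^{i_d}_{k^u_d}\in J$ and $j\in\prod_l[s_{i_l}]$, $g_j=\sum_u c_u\,z^{i_1}_{j_1k^u_1}\cdots z^{i_d}_{j_dk^u_d}$, and $\mathrm{Lift}(G)=\{g_j\}$. *)

(* Defs.v *)
From HB Require Import structures.
From mathcomp Require Import all_boot all_order all_algebra.
From mathcomp Require Import mpoly.
Set Implicit Arguments. Unset Strict Implicit. Unset Printing Implicit Defensive.
Import Order.TTheory GRing.Theory Num.Theory.
Local Open Scope ring_scope.

Definition kpoly (K : fieldType) (V : finType) := {mpoly K[#|V|]}.

Definition var (K : fieldType) (V : finType) (v : V) : kpoly K V :=
  'X_(enum_rank v).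

Definition psub (K : fieldType) (V W : finType) (h : V -> kpoly K W)
  (p : kpoly K V) : kpoly K W :=
  mmap (@mpolyC _ K) (fun i => h (enum_val i)) p.

Definition is_ideal (K : fieldType) (V : finType) (I : kpoly K V -> Prop) :=
  [/\ I 0, (forall p q, I p -> I q -> I (p + q)) & (forall p q, I q -> I (p * q))].

Definition ideal_gen (K : fieldType) (V : finType) (S : kpoly K V -> Prop)
  (p : kpoly K V) : Prop :=
  exists l : seq (kpoly K V * kpoly K V),
    (forall cg, cg \in l -> S cg.2) /\ p = \sum_(cg <- l) cg.1 * cg.2.

Definition same_ideal (K : fieldType) (V : finType) (P Q : kpoly K V -> Prop) :=
  forall p, P p <-> Q p.

Definition wt (R : realFieldType) (V : finType) (nu : V -> R)
  (m : 'X_{1..#|V|}) : R :=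
  \sum_(v : V) nu v * (m (enum_rank v))%:R.

Definition initf (K : fieldType) (R : realFieldType) (V : finType)
  (nu : V -> R) (f : kpoly K V) : kpoly K V :=
  \sum_(m <- msupp f | all (fun m' => wt nu m' <= wt nu m) (msupp f))
     f@_m *: 'X_[m].

Definition initial_ideal (K : fieldType) (R : realFieldType) (V : finType)
  (nu : V -> R) (I : kpoly K V -> Prop) : kpoly K V -> Prop :=
  ideal_gen (fun q => exists f, I f /\ q = initf nu f).

Definition monomial_ideal (K : fieldType) (V : finType) (P : kpoly K V -> Prop) :=
  exists M : 'X_{1..#|V|} -> Prop,
    same_ideal P (ideal_gen (fun q => exists m, M m /\ q = 'X_[m])).

(* G (a finite set, given as a predicate) is a pseudo-Groebner basis of I *)
Definition pseudo_GB (K : fieldType) (R : realFieldType) (V : finType)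
  (G : kpoly K V -> Prop) (nu : V -> R) (I : kpoly K V -> Prop) :=
  (forall g, G g -> I g) /\
  same_ideal (ideal_gen (fun q => exists g, G g /\ q = initf nu g))
             (initial_ideal nu I).

Definition GB (K : fieldType) (R : realFieldType) (V : finType)
  (G : seq (kpoly K V)) (nu : V -> R) (I : kpoly K V -> Prop) :=
  pseudo_GB (fun g => g \in G) nu I /\ monomial_ideal (initial_ideal nu I).

(* x^i_j with i in [r], j in [s_i] (0-based indices) *)
Definition Vars (r : nat) (s : 'I_r -> nat) : finType := {i : 'I_r & 'I_(s i)}.

(* z^i_{jk} : pairs (x^i_j, y^i_k) with the same upper index *)
Definition Zvars (r : nat) (s t : 'I_r -> nat) : finType :=
  {p : Vars s * Vars t | tag p.1 == tag p.2}.

(* the variable z^i_{jk} from (x^i_j, y^i_k) (0 if upper indices differ) *)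
Definition zpair (K : fieldType) (r : nat) (s t : 'I_r -> nat)
  (p : Vars s * Vars t) : kpoly K (Zvars s t) :=
  if insub p is Some z then @var K (Zvars s t) z else 0.

Definition mdeg (r d : nat) (s : 'I_r -> nat) (a : 'I_r -> 'rV[int]_d)
  (m : 'X_{1..#|Vars s|}) : 'rV[int]_d :=
  \sum_(v : Vars s) a (tag v) *+ m (enum_rank v).

Definition homogeneous (K : fieldType) (r d : nat) (s : 'I_r -> nat)
  (a : 'I_r -> 'rV[int]_d) (f : kpoly K (Vars s)) :=
  exists delta, forall m, m \in msupp f -> mdeg a m = delta.

Definition hcomp (K : fieldType) (r d : nat) (s : 'I_r -> nat)
  (a : 'I_r -> 'rV[int]_d) (f : kpoly K (Vars s)) (delta : 'rV[int]_d) :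
  kpoly K (Vars s) :=
  \sum_(m <- msupp f | mdeg a m == delta) f@_m *: 'X_[m].

Definition homog_ideal (K : fieldType) (r d : nat) (s : 'I_r -> nat)
  (a : 'I_r -> 'rV[int]_d) (I : kpoly K (Vars s) -> Prop) :=
  is_ideal I /\ forall f delta, I f -> I (hcomp a f delta).

(* Toric fiber product.  K[x]/I (x) K[y]/J is identified with
   K[x,y]/(I K[x,y] + J K[x,y]); the toric fiber product is the kernel of
   K[z] -> K[x,y]/(I K[x,y] + J K[x,y]), z^i_{jk} |-> x^i_j y^i_k. *)
Definition XY (r : nat) (s t : 'I_r -> nat) : finType := (Vars s + Vars t)%type.

Definition incl_x (K : fieldType) (r : nat) (s t : 'I_r -> nat)
  (p : kpoly K (Vars s)) : kpoly K (XY s t) :=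
  psub (fun v => @var K (XY s t) (inl v)) p.

Definition incl_y (K : fieldType) (r : nat) (s t : 'I_r -> nat)
  (p : kpoly K (Vars t)) : kpoly K (XY s t) :=
  psub (fun v => @var K (XY s t) (inr v)) p.

Definition phiB (K : fieldType) (r : nat) (s t : 'I_r -> nat)
  (h : kpoly K (Zvars s t)) : kpoly K (XY s t) :=
  psub (fun z : Zvars s t => @var K (XY s t) (inl (val z).1) * @var K (XY s t) (inr (val z).2)) h.

Definition toric_fiber_product (K : fieldType) (r : nat) (s t : 'I_r -> nat)
  (I : kpoly K (Vars s) -> Prop) (J : kpoly K (Vars t) -> Prop)
  (h : kpoly K (Zvars s t)) : Prop :=
  ideal_gen (fun q => (exists p, I p /\ q = incl_x t p) \/
                      (exists p, J p /\ q = incl_y s p)) (phiB h).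

Definition pullback_weight (R : realFieldType) (r : nat) (s t : 'I_r -> nat)
  (w1 : Vars s -> R) (w2 : Vars t -> R) (z : Zvars s t) : R :=
  w1 (val z).1 + w2 (val z).2.

(* Lifts.  A presentation of f is a list of terms (c_u, word_u) where each
   word is a sequence of variables x^{i_1}_{j_1} ... x^{i_d}_{j_d} with the
   common upper-index sequence ii = (i_1,...,i_d), such that
   f = sum_u c_u x^{i_1}_{j^u_1} ... x^{i_d}_{j^u_d}, the coefficients are
   nonzero and the monomials of distinct terms are distinct (i.e. the terms
   are the terms of f, each written with a reordering of its factors). *)
Definition presentation (K : fieldType) (r : nat) (s : 'I_r -> nat)
  (f : kpoly K (Vars s)) (ii : seq 'I_r) (ts : seq (K * seq (Vars s))) :=
  [/\ (forall cw, cw \in ts -> (cw.1 != 0) /\ map tag cw.2 = ii),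
      uniq [seq \prod_(v <- cw.2) @var K (Vars s) v | cw <- ts]
    & f = \sum_(cw <- ts) cw.1 *: \prod_(v <- cw.2) @var K (Vars s) v].

(* Lift(F): all f_k, f in F, k in T_f (k given as a word of y-variables
   y^{i_1}_{k_1} ... y^{i_d}_{k_d}); P f is the chosen presentation of f *)
Definition LiftF (K : fieldType) (r : nat) (s t : 'I_r -> nat)
  (F : seq (kpoly K (Vars s)))
  (P : kpoly K (Vars s) -> seq 'I_r * seq (K * seq (Vars s)))
  (h : kpoly K (Zvars s t)) : Prop :=
  exists f, f \in F /\ exists k : seq (Vars t), map tag k = (P f).1 /\
    h = \sum_(cw <- (P f).2) cw.1 *: \prod_(pr <- zip cw.2 k) zpair K pr.

Definition LiftG (K : fieldType) (r : nat) (s t : 'I_r -> nat)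
  (G : seq (kpoly K (Vars t)))
  (Q : kpoly K (Vars t) -> seq 'I_r * seq (K * seq (Vars t)))
  (h : kpoly K (Zvars s t)) : Prop :=
  exists g, g \in G /\ exists j : seq (Vars s), map tag j = (Q g).1 /\
    h = \sum_(cw <- (Q g).2) cw.1 *: \prod_(pr <- zip j cw.2) zpair K pr.

Definition QuadB (K : fieldType) (r : nat) (s t : 'I_r -> nat)
  (h : kpoly K (Zvars s t)) : Prop :=
  exists (v1 v2 : Vars s) (u1 u2 : Vars t),
    [/\ tag v2 = tag v1, tag u1 = tag v1, tag u2 = tag v1,
        (tagged v1 < tagged v2)%N & (tagged u1 < tagged u2)%N] /\
        h = zpair K (v1, u2) * zpair K (v2, u1)
            - zpair K (v1, u1) * zpair K (v2, u2).

(* Main.v *)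
(* Write S for the ideal of K[x,y] generated by I and J.  A monomial of top
   weight of an element of S has its x-part in in(I) or its y-part in in(J):
   otherwise the linear functionals that kill I, resp. J, and pick out these
   standard x- and y-parts among the monomials of at most their weight have a
   tensor product that kills S but not that element.  Hence phi_B(in h) lies in
   in(I) + in(J) for every h in the toric fiber product.  The image of phi_B is
   spanned by the balanced monomials, and a balanced multiple of some in(f),
   f in F, is the image of a multiple of the initial form of a lift of f, because
   its y-part contains a word with the index sequence of f.  So in h agrees with
   a combination of initial forms of lifts up to ker phi_B, which the quadrics
   generate. *)
Require Import Defs.
From HB Require Import structures.
From mathcomp Require Import all_boot all_order all_algebra.
From mathcomp Require Import ssrcomplements mpoly.
From mathcomp Require Import ring lra.
From Stdlib Require Import Classical ClassicalEpsilon.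
Set Implicit Arguments. Unset Strict Implicit. Unset Printing Implicit Defensive.
Import Order.TTheory GRing.Theory Num.Theory.
Local Open Scope ring_scope.

(** * Linear extension from monomials, and selection of terms *)

Definition linext (K : fieldType) (n : nat) (U : lmodType K)
  (phi : 'X_{1..n} -> U) (p : {mpoly K[n]}) : U :=
  \sum_(m <- msupp p) p@_m *: phi m.

(** Padding the support with zero coefficients to all monomials below a common size bound lets sums
    for different polynomials be compared termwise; linearity follows from this. *)
Lemma linextE (K : fieldType) (n : nat) (U : lmodType K)
  (phi : 'X_{1..n} -> U) (k : nat) (p : {mpoly K[n]}) :
  (msize p <= k)%N ->
  linext phi p = \sum_(m : 'X_{1..n < k}) p@_m *: phi m.
Proof.
move=> le_pk; set B : subFinType _ := 'X_{1..n < k}.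
rewrite /linext (big_mksub B) ?msupp_uniq //=; first last.
  by move=> x /msize_mdeg_lt /leq_trans; apply.
rewrite big_rmcond //= => j /memN_msupp_eq0 ->.
by rewrite scale0r.
Qed.

Lemma linext_is_linear (K : fieldType) (n : nat) (U : lmodType K)
  (phi : 'X_{1..n} -> U) : linear (linext phi).
Proof.
move=> c p q; pose k := maxn (msize p) (maxn (msize q) (msize (c *: p + q))).
rewrite !(@linextE _ _ _ _ k) ?leq_max ?leqnn ?orbT //.
rewrite scaler_sumr -big_split /=; apply: eq_bigr => m _.
by rewrite mcoeffD mcoeffZ scalerDl scalerA.
Qed.

HB.instance Definition _ (K : fieldType) (n : nat) (U : lmodType K)
  (phi : 'X_{1..n} -> U) :=
  GRing.isLinear.Build K {mpoly K[n]} U _ (linext phi) (linext_is_linear phi).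

Lemma linextX (K : fieldType) (n : nat) (U : lmodType K)
  (phi : 'X_{1..n} -> U) (m : 'X_{1..n}) : linext phi 'X_[m] = phi m.
Proof. by rewrite /linext msuppX big_seq1 mcoeffX eqxx scale1r. Qed.

Lemma linext_eq (K : fieldType) (n : nat) (U : lmodType K)
  (f g : {linear {mpoly K[n]} -> U}) :
  (forall m, f 'X_[m] = g 'X_[m]) -> forall p, f p = g p.
Proof.
move=> fg p; rewrite [p]mpolyE !linear_sum.
by apply: eq_bigr => m _; rewrite !linearZ /= fg.
Qed.

(** This form covers [hcomp], the projection to balanced monomials, and [initf], whose predicate
    depends on [f] itself. With the predicate fixed the selection is linear, and [initf_top] brings
    [initf] into that shape. *)
Definition mfilt (K : fieldType) (n : nat) (P : pred 'X_{1..n})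
  (f : {mpoly K[n]}) : {mpoly K[n]} :=
  \sum_(m <- msupp f | P m) f@_m *: 'X_[m].

Lemma mfilt_is_linear (K : fieldType) (n : nat) (P : pred 'X_{1..n}) :
  linear (@mfilt K n P).
Proof.
pose phi m : {mpoly K[n]} := if P m then 'X_[m] else 0.
have mfiltE (f : {mpoly K[n]}) : mfilt P f = linext phi f.
  rewrite /mfilt /linext big_mkcond; apply: eq_bigr => m _.
  by rewrite /phi; case: (P m); rewrite ?scaler0.
by move=> c p q; rewrite !mfiltE linearP.
Qed.

HB.instance Definition _ (K : fieldType) (n : nat) (P : pred 'X_{1..n}) :=
  GRing.isLinear.Build K {mpoly K[n]} {mpoly K[n]} _ (mfilt P)
    (@mfilt_is_linear K n P).

Lemma mfiltX (K : fieldType) (n : nat) (P : pred 'X_{1..n}) (m : 'X_{1..n}) :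
  mfilt P ('X_[m] : {mpoly K[n]}) = if P m then 'X_[m] else 0.
Proof.
rewrite /mfilt msuppX big_mkcond big_seq1 mcoeffX eqxx scale1r.
by case: (P m).
Qed.

Lemma mcoeff_mfilt (K : fieldType) (n : nat) (P : pred 'X_{1..n})
  (f : {mpoly K[n]}) (m : 'X_{1..n}) :
  (mfilt P f)@_m = if P m then f@_m else 0.
Proof.
rewrite [f in RHS]mpolyE /mfilt !raddf_sum /= big_mkcond.
case Pm: (P m).
  apply: eq_bigr => k _; rewrite mcoeffZ mcoeffX.
  by case: eqVneq => [->|_]; rewrite ?Pm ?mulr0 ?if_same.
apply: big1 => k _; case Pk: (P k) => //; rewrite mcoeffZ mcoeffX.
by case: (eqVneq k m) Pk Pm => [->->//|_ _ _]; rewrite mulr0.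
Qed.

Lemma msupp_mfilt (K : fieldType) (n : nat) (P : pred 'X_{1..n})
  (f : {mpoly K[n]}) (m : 'X_{1..n}) :
  (m \in msupp (mfilt P f)) = P m && (m \in msupp f).
Proof. by rewrite !mcoeff_msupp mcoeff_mfilt; case: (P m); rewrite ?eqxx. Qed.

Lemma mfilt_id (K : fieldType) (n : nat) (P : pred 'X_{1..n})
  (f : {mpoly K[n]}) : {in msupp f, forall m, P m} -> mfilt P f = f.
Proof.
move=> Pf; apply/mpolyP => m; rewrite mcoeff_mfilt; case: ifP => // nPm.
by apply/esym/memN_msupp_eq0; apply/negP => /Pf; rewrite nPm.
Qed.

Lemma mfilt_eq0 (K : fieldType) (n : nat) (P : pred 'X_{1..n})
  (f : {mpoly K[n]}) : {in msupp f, forall m, ~~ P m} -> mfilt P f = 0.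
Proof.
move=> Pf; apply/mpolyP => m; rewrite mcoeff_mfilt mcoeff0; case: ifP => // Pm.
by apply: memN_msupp_eq0; apply/negP => /Pf; rewrite Pm.
Qed.

Lemma mfiltXM (K : fieldType) (n : nat) (P Q : pred 'X_{1..n}) (m : 'X_{1..n})
  (f : {mpoly K[n]}) : (forall k, P (m + k)%MM = Q k) ->
  mfilt P ('X_[m] * f) = 'X_[m] * mfilt Q f.
Proof.
move=> PQ; rewrite [f]mpolyE mulr_sumr !linear_sum mulr_sumr.
apply: eq_bigr => k _; rewrite -scalerAr !linearZ /= -scalerAr -mpolyXD !mfiltX PQ.
by case: (Q k); rewrite ?mulr0 // mpolyXD.
Qed.

(** * Generated ideals *)

Lemma ideal_gen_mem (K : fieldType) (V : finType) (S : kpoly K V -> Prop)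
  (p : kpoly K V) : S p -> ideal_gen S p.
Proof.
move=> Sp; exists [:: (1, p)]; split; last by rewrite big_seq1 mul1r.
by move=> cg; rewrite inE => /eqP ->.
Qed.

Lemma ideal_gen_ideal (K : fieldType) (V : finType) (S : kpoly K V -> Prop) :
  is_ideal (ideal_gen S).
Proof.
split.
- by exists [::]; rewrite big_nil.
- move=> _ _ [l [Sl ->]] [l' [Sl' ->]]; exists (l ++ l'); rewrite big_cat.
  by split=> // cg; rewrite mem_cat => /orP[/Sl|/Sl'].
- move=> p _ [l [Sl ->]]; exists [seq (p * cg.1, cg.2) | cg <- l]; split.
    by move=> _ /mapP[cg /Sl Scg ->].
  by rewrite big_map mulr_sumr; apply: eq_bigr => cg _; rewrite mulrA.
Qed.

Lemma ideal_sum (K : fieldType) (V : finType) (I : kpoly K V -> Prop)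
  (T : eqType) (l : seq T) (F : T -> kpoly K V) :
  is_ideal I -> (forall x, x \in l -> I (F x)) -> I (\sum_(x <- l) F x).
Proof.
move=> [I0 ID _]; elim: l => [|x l IH] Il; first by rewrite big_nil.
rewrite big_cons; apply: ID; first by apply: Il; rewrite mem_head.
by apply: IH => y yl; apply: Il; rewrite inE yl orbT.
Qed.

Lemma ideal_gen_min (K : fieldType) (V : finType) (S I : kpoly K V -> Prop) :
  is_ideal I -> (forall q, S q -> I q) -> forall p, ideal_gen S p -> I p.
Proof.
move=> idI SI _ [l [Sl ->]]; apply: ideal_sum => // cg /Sl /SI.
by have [_ _] := idI; apply.
Qed.

Lemma ideal_scale (K : fieldType) (V : finType) (I : kpoly K V -> Prop)
  (c : K) (p : kpoly K V) : is_ideal I -> I p -> I (c *: p).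
Proof. by move=> [_ _ IM] /(IM c%:MP); rewrite mul_mpolyC. Qed.

(** Splitting each coefficient into its terms leaves only monomial multiples of generators. [I] has
    to be closed under linear combinations only, so the kernel of a functional qualifies. *)
Lemma ideal_gen_ind (K : fieldType) (V : finType) (S I : kpoly K V -> Prop) :
  I 0 -> (forall p q, I p -> I q -> I (p + q)) ->
  (forall c p, I p -> I (c *: p)) ->
  (forall m q, S q -> I ('X_[m] * q)) -> forall p, ideal_gen S p -> I p.
Proof.
move=> I0 ID IZ IX _ [l [Sl ->]]; rewrite big_seq.
elim/big_rec: _ => // -[c g] q /Sl /= Sg Iq; apply: (ID) => //.
rewrite [c]mpolyE mulr_suml; elim/big_rec: _ => // m q' _ Iq'.
by apply: ID => //; rewrite -scalerAl; apply/IZ/IX.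
Qed.

(** * Monomial maps and their exponent matrices, with columns [mu v] *)

Definition mnsub (V W : finType) (mu : V -> 'X_{1..#|W|}) (m : 'X_{1..#|V|}) :
  'X_{1..#|W|} := (\sum_(i < #|V|) mu (enum_val i) *+ m i)%MM.

Lemma mulmDn (n : nat) (m : 'X_{1..n}) (i j : nat) :
  (m *+ (i + j) = m *+ i + m *+ j)%MM.
Proof. by apply/mnmP => k; rewrite mnmDE !mulmnE mulnDr. Qed.

Lemma mnsub0 (V W : finType) (mu : V -> 'X_{1..#|W|}) : mnsub mu 0%MM = 0%MM.
Proof. by rewrite /mnsub big1 // => i _; rewrite mnm0E mulm0n. Qed.

Lemma mnsubD (V W : finType) (mu : V -> 'X_{1..#|W|}) (m1 m2 : 'X_{1..#|V|}) :
  mnsub mu (m1 + m2)%MM = (mnsub mu m1 + mnsub mu m2)%MM.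
Proof.
by rewrite /mnsub -big_split; apply: eq_bigr => i _; rewrite mnmDE mulmDn.
Qed.

Lemma mnsubU (V W : finType) (mu : V -> 'X_{1..#|W|}) (v : V) :
  mnsub mu U_(enum_rank v)%MM = mu v.
Proof.
rewrite /mnsub (bigD1 (enum_rank v)) //= mnm1E eqxx enum_rankK mulm1n.
rewrite big1 ?addm0 // => i ne_iv.
by rewrite mnm1E eq_sym (negbTE ne_iv) mulm0n.
Qed.

Lemma psub_is_linear (K : fieldType) (V W : finType) (h : V -> kpoly K W) :
  linear (psub h).
Proof. by move=> c p q; rewrite /psub mmapD mmapZ mul_mpolyC. Qed.

HB.instance Definition _ (K : fieldType) (V W : finType) (h : V -> kpoly K W) :=
  GRing.isLinear.Build K (kpoly K V) (kpoly K W) _ (psub h) (psub_is_linear h).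

Lemma psubM (K : fieldType) (V W : finType) (h : V -> kpoly K W)
  (p q : kpoly K V) : psub h (p * q) = psub h p * psub h q.
Proof. exact: rmorphM. Qed.

Lemma psubX (K : fieldType) (V W : finType) (h : V -> kpoly K W)
  (mu : V -> 'X_{1..#|W|}) (m : 'X_{1..#|V|}) :
  (forall v, h v = 'X_[mu v]) -> psub h 'X_[m] = 'X_[mnsub mu m].
Proof.
move=> hE; rewrite /psub mmapX /mmap1 -mprodXnE.
by apply: eq_bigr => i _; rewrite hE.
Qed.

Lemma msupp_psub (K : fieldType) (V W : finType) (h : V -> kpoly K W)
  (mu : V -> 'X_{1..#|W|}) (p : kpoly K V) (m : 'X_{1..#|W|}) :
  (forall v, h v = 'X_[mu v]) -> m \in msupp (psub h p) ->
  exists2 k, k \in msupp p & m = mnsub mu k.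
Proof.
move=> hE; rewrite [p in psub h p]mpolyE linear_sum /=.
move=> /msupp_sum_le/flattenP[/= ms /mapP[k]]; rewrite mem_filter => /= kp ->.
rewrite linearZ /= (psubX _ hE) => /msuppZ_le; rewrite msuppX inE => /eqP ->.
by exists k.
Qed.

(** Both sides are linear in [p] and agree on monomials, so the map may merge or cancel terms. This
    is how initial forms are carried through [phiB]. *)
Lemma mfilt_psub (K : fieldType) (V W : finType) (h : V -> kpoly K W)
  (mu : V -> 'X_{1..#|W|}) (P : pred 'X_{1..#|W|}) (Q : pred 'X_{1..#|V|})
  (p : kpoly K V) :
  (forall v, h v = 'X_[mu v]) -> (forall m, P (mnsub mu m) = Q m) ->
  mfilt P (psub h p) = psub h (mfilt Q p).
Proof.
move=> hE PQ.
apply: (@linext_eq K _ _ (mfilt P \o psub h) (psub h \o mfilt Q)) => m /=.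
by rewrite (psubX _ hE) !mfiltX PQ; case: (Q m); rewrite ?linear0 ?(psubX _ hE).
Qed.

(** * Weights of monomials *)

Lemma wt0 (R : realFieldType) (V : finType) (nu : V -> R) : wt nu 0%MM = 0.
Proof. by rewrite /wt big1 // => v _; rewrite mnm0E mulr0. Qed.

Lemma wtD (R : realFieldType) (V : finType) (nu : V -> R)
  (m1 m2 : 'X_{1..#|V|}) : wt nu (m1 + m2)%MM = wt nu m1 + wt nu m2.
Proof.
rewrite /wt -big_split; apply: eq_bigr => v _.
by rewrite mnmDE natrD mulrDr.
Qed.

Lemma wtU (R : realFieldType) (V : finType) (nu : V -> R) (v : V) :
  wt nu U_(enum_rank v)%MM = nu v.
Proof.
rewrite /wt (bigD1 v) //= mnm1E eqxx mulr1 big1 ?addr0 // => u ne_uv.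
by rewrite mnm1E (inj_eq enum_rank_inj) eq_sym (negbTE ne_uv) mulr0.
Qed.

Lemma wtMn (R : realFieldType) (V : finType) (nu : V -> R)
  (m : 'X_{1..#|V|}) (k : nat) : wt nu (m *+ k)%MM = wt nu m *+ k.
Proof.
elim: k => [|k IH]; first by rewrite mulm0n wt0.
by rewrite mulmS wtD IH mulrS.
Qed.

(** The exponent matrix moves to the other side of the pairing; this adjunction is what makes
    pullback weights work. *)
Lemma wt_mnsub (R : realFieldType) (V W : finType) (mu : V -> 'X_{1..#|W|})
  (nu : W -> R) (m : 'X_{1..#|V|}) :
  wt nu (mnsub mu m) = wt (fun v => wt nu (mu v)) m.
Proof.
rewrite /mnsub (big_morph _ (wtD nu) (wt0 nu)) [RHS]/wt.
rewrite [RHS](reindex_onto enum_val enum_rank) => [|v _]; last exact: enum_rankK.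
apply: eq_big => [i|i _]; first by rewrite enum_valK eqxx.
by rewrite wtMn enum_valK mulr_natr.
Qed.

Lemma wt_ext (R : realFieldType) (V : finType) (nu nu' : V -> R)
  (m : 'X_{1..#|V|}) : nu =1 nu' -> wt nu m = wt nu' m.
Proof. by move=> e; apply: eq_bigr => v _; rewrite e. Qed.

(** * Separating a vector from a subspace by a functional *)

Lemma subspace_mx (K : fieldType) (n : nat) (W : 'rV[K]_n -> Prop) :
  W 0 -> (forall c x y, W x -> W y -> W (c *: x + y)) ->
  exists A : 'M[K]_n, forall x, W x <-> (x <= A)%MS.
Proof.
move=> W0 WL.
(* The subspace is a mere predicate, so a matrix is grown inside it: while some vector of [W] lies
   outside the row space it is adjoined. The corank, bounded by [k], drops each time. *)
suff H k (A : 'M[K]_n) : (n - \rank A <= k)%N ->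
    (forall x : 'rV_n, (x <= A)%MS -> W x) ->
    exists A : 'M[K]_n, forall x, W x <-> (x <= A)%MS.
  by apply: (H n 0) => [|x]; rewrite ?leq_subr // submx0 => /eqP ->.
elim: k A => [|k IH] A rkA AW.
  exists A => x; split=> [_|/AW//]; apply: submx_full.
  by rewrite /row_full eqn_leq rank_leq_col /= -subn_eq0 -leqn0.
case: (classic (exists2 x, W x & ~ (x <= A)%MS)) => [[x Wx nxA]|nex].
  apply: (IH (A + x)%MS) => [|y /sub_addsmxP[[u v] ->] /=]; last first.
    rewrite addrC [v]mx11_scalar mul_scalar_mx; apply: WL => //.
    by apply: AW; rewrite submxMl.
  have lt_rk : (\rank A < \rank (A + x)%MS)%N.
    suff: (A < A + x)%MS by rewrite ltmxErank => /andP[].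
    rewrite /ltmx addsmxSl; apply/negP => le_A; apply: nxA; apply: submx_trans le_A.
    exact: addsmxSr.
  rewrite -ltnS; apply: leq_trans rkA; rewrite ltn_sub2l //.
  by rewrite (leq_trans lt_rk) ?rank_leq_col.
exists A => x; split=> [Wx|/AW//]; apply/negPn/negP => nxA.
by apply: nex; exists x => //; apply/negP.
Qed.

(** The cokernel matrix of [W] annihilates exactly the vectors of [W], so one of its columns is
    nonzero on [v]; that column, rescaled, is the functional. *)
Lemma separating_cV (K : fieldType) (n : nat) (W : 'rV[K]_n -> Prop)
  (v : 'rV[K]_n) :
  W 0 -> (forall c x y, W x -> W y -> W (c *: x + y)) -> ~ W v ->
  exists2 u : 'cV[K]_n, (v *m u) 0 0 = 1 & forall x, W x -> x *m u = 0.
Proof.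
move=> W0 WL; have [A WA] := subspace_mx W0 WL; rewrite WA submxE => /negP nz.
move: (cokermx A) (fun x : 'rV_n => submxE x A) nz => C CE nz.
have [j nzj] : exists j, (v *m C) 0 j != 0.
  apply/existsP; apply: contraNT nz => /existsPn/= z.
  by apply/eqP/rowP => j; rewrite [RHS]mxE; apply/eqP; have := z j; rewrite negbK.
exists (((v *m C) 0 j)^-1 *: col j C).
  by rewrite -scalemxAr [col j C]colE mulmxA -colE [LHS]mxE [X in _ * X]mxE mulVf.
move=> x /WA; rewrite CE => /eqP xC.
by rewrite -scalemxAr colE mulmxA xC mul0mx scaler0.
Qed.

(** * Initial forms and monomial ideals *)

Lemma initf_top (K : fieldType) (R : realFieldType) (V : finType)
  (nu : V -> R) (w : R) (f : kpoly K V) :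
  {in msupp f, forall m, wt nu m <= w} ->
  (exists2 m, m \in msupp f & wt nu m = w) ->
  initf nu f = mfilt (fun m => wt nu m == w) f.
Proof.
move=> le_w [m0 m0f wm0]; rewrite /initf /mfilt big_seq_cond [RHS]big_seq_cond.
apply: eq_bigl => m; case mf: (m \in msupp f) => //=.
apply/allP/eqP => [top|-> k /le_w//]; apply/le_anti.
by rewrite le_w //= -wm0 top.
Qed.

Lemma msupp_top (K : fieldType) (R : realFieldType) (V : finType)
  (nu : V -> R) (f : kpoly K V) : f != 0 ->
  exists2 m, m \in msupp f & {in msupp f, forall k, wt nu k <= wt nu m}.
Proof.
rewrite -msupp_eq0; elim: (msupp f) => // m l IH _.
have [->|/IH[k kl top]] := eqVneq l [::].
  by exists m; rewrite ?mem_head // => k; rewrite inE => /eqP ->.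
have [le_mk|/ltW le_km] := lerP (wt nu m) (wt nu k).
  exists k; first by rewrite inE kl orbT.
  by move=> j; rewrite inE => /orP[/eqP->|/top].
exists m; rewrite ?mem_head // => j; rewrite inE => /orP[/eqP->//|/top].
by move/le_trans; apply.
Qed.

Lemma initf0 (K : fieldType) (R : realFieldType) (V : finType) (nu : V -> R) :
  initf nu (0 : kpoly K V) = 0.
Proof. by rewrite /initf msupp0 big_nil. Qed.

Lemma initf_homog (K : fieldType) (R : realFieldType) (V : finType)
  (nu : V -> R) (w : R) (f : kpoly K V) :
  {in msupp f, forall m, wt nu m = w} -> initf nu f = f.
Proof.
move=> fw; have [->|/(msupp_top nu)[m mf _]] := eqVneq f 0; first exact: initf0.
rewrite (@initf_top _ _ _ _ w); last by exists m; rewrite ?fw.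
  by apply: mfilt_id => k /fw ->.
by move=> k /fw ->.
Qed.

Lemma mcoeff_initf (K : fieldType) (R : realFieldType) (V : finType)
  (nu : V -> R) (f : kpoly K V) (m : 'X_{1..#|V|}) : m \in msupp f ->
  {in msupp f, forall k, wt nu k <= wt nu m} -> (initf nu f)@_m = f@_m.
Proof.
move=> mf top; rewrite (@initf_top _ _ _ _ (wt nu m)) //; last by exists m.
by rewrite mcoeff_mfilt eqxx.
Qed.

(** Every term of a multiple of a generating monomial is divisible by that monomial, and sums create
    no new monomials. *)
Lemma monomial_idealP (K : fieldType) (V : finType) (P : kpoly K V -> Prop)
  (q : kpoly K V) (m : 'X_{1..#|V|}) :
  is_ideal P -> monomial_ideal P -> P q -> m \in msupp q -> P 'X_[m].
Proof.
move=> [_ _ PM] [M PE] /PE Pq; move: q Pq m.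
apply: ideal_gen_ind => [m|p q Pp Pq m|c p Pp m|m _ [k [Mk ->]] m'].
- by rewrite msupp0.
- by move/msuppD_le; rewrite mem_cat => /orP[/Pp|/Pq].
- by move/msuppZ_le/Pp.
rewrite -mpolyXD msuppX inE => /eqP ->; rewrite mpolyXD; apply/PM/PE.
by apply: ideal_gen_mem; exists k.
Qed.

(** * Functionals that detect standard monomials *)

Lemma mdeg_multidegree (r d : nat) (s : 'I_r -> nat) (a : 'I_r -> 'rV[int]_d)
  (omega : 'rV[rat]_d) (m : 'X_{1..#|Vars s|}) :
  (forall i, \sum_(l < d) omega 0 l * ((a i 0 l)%:~R : rat) = 1) ->
  \sum_(l < d) omega 0 l * (Defs.mdeg a m 0 l)%:~R = (mdeg m)%:R.
Proof.
move=> omega1; rewrite /Defs.mdeg mdegE natr_sum.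
rewrite (reindex_onto enum_rank enum_val) => [|i _]; last exact: enum_valK.
transitivity (\sum_(l < d) \sum_(v : Vars s)
    omega 0 l * (a (tag v) 0 l)%:~R * (m (enum_rank v))%:R).
  apply: eq_bigr => l _; rewrite summxE rmorph_sum mulr_sumr.
  by apply: eq_bigr => v _; rewrite mulmxnE rmorphMn /= -mulrA mulr_natr.
rewrite exchange_big; apply: eq_big => v; first by rewrite enum_rankK eqxx.
by move=> _; rewrite -mulr_suml omega1 mul1r.
Qed.

(* The functional is built on the degree component of [alpha], which is
   finite-dimensional since [omega] makes the total degree a function of the
   multidegree. *)
Lemma separating_functional (K : fieldType) (R : realFieldType)
  (r d : nat) (s : 'I_r -> nat) (a : 'I_r -> 'rV[int]_d) (omega : 'rV[rat]_d)
  (I : kpoly K (Vars s) -> Prop) (w : Vars s -> R)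
  (alpha : 'X_{1..#|Vars s|}) :
  (forall i, \sum_(l < d) omega 0 l * ((a i 0 l)%:~R : rat) = 1) ->
  homog_ideal a I -> monomial_ideal (initial_ideal w I) ->
  ~ initial_ideal w I 'X_[alpha] ->
  exists c : 'X_{1..#|Vars s|} -> K^o,
    [/\ forall f, I f -> linext c f = 0, c alpha = 1
      & forall m, m != alpha -> wt w m <= wt w alpha -> c m = 0].
Proof.
move=> omega1 [idI homI] monI alpha_std; have [I0 ID IM] := idI.
pose B : finType := 'X_{1..#|Vars s| < (mdeg alpha).+1}.
pose e (i : 'I_#|B|) : 'X_{1..#|Vars s|} := bmnm (enum_val i).
(* Apart from [alpha], only strictly heavier coordinates are kept: the monomials on which the
   functional must vanish are projected away in advance. *)
pose U (m : 'X_{1..#|Vars s|}) :=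
  (Defs.mdeg a m == Defs.mdeg a alpha) &&
  ((m == alpha) || (wt w alpha < wt w m)).
pose vec (f : kpoly K (Vars s)) : 'rV[K]_#|B| :=
  \row_i if U (e i) then f@_(e i) else 0.
have vecP c f g : vec (c *: f + g) = c *: vec f + vec g.
  apply/rowP => i; rewrite !mxE; case: ifP => _; last by rewrite mulr0 addr0.
  by rewrite mcoeffD mcoeffZ.
have vec0 : vec 0 = 0 by apply/rowP => i; rewrite !mxE mcoeff0 if_same.
pose W x := exists2 f, I f & x = vec f.
(* If some [f] in [I] had this projection, its component in the degree of [alpha] would have [alpha]
   in its initial form. The initial ideal is monomial, so it would contain [alpha]. *)
have nW : ~ W (vec 'X_[alpha]).
  move=> [f If /rowP vecE]; apply: alpha_std.
  pose f' := hcomp a f (Defs.mdeg a alpha).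
  have If' : I f' by apply: homI.
  have f'E m : f'@_m = if Defs.mdeg a m == Defs.mdeg a alpha then f@_m else 0.
    exact: mcoeff_mfilt.
  have fE m : U m -> f@_m = (alpha == m)%:R.
    (* Equal multidegrees force equal total degrees, through [omega]; hence [m] is one of the
       finitely many coordinates in [B]. *)
    move=> Um; have lt_m : (mdeg m < (mdeg alpha).+1)%N.
      rewrite ltnS -(ler_nat rat) -!(mdeg_multidegree _ omega1).
      by have /andP[/eqP-> _] := Um.
    have := vecE (enum_rank (BMultinom lt_m : B)).
    by rewrite !mxE /e enum_rankK /= Um mcoeffX => ->.
  have f'alpha : f'@_alpha = 1 by rewrite f'E eqxx fE ?eqxx // /U !eqxx.
  have alphaf' : alpha \in msupp f' by rewrite mcoeff_msupp f'alpha oner_neq0.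
  have top : {in msupp f', forall m, wt w m <= wt w alpha}.
    move=> m; rewrite mcoeff_msupp f'E leNgt; case: ifP => [em|]; last by rewrite eqxx.
    apply: contra => lt_m; rewrite fE ?/U ?em ?lt_m ?orbT //.
    by case: (eqVneq alpha m) lt_m => [->|]; rewrite ?ltxx ?eqxx.
  apply: (monomial_idealP (q := initf w f') _ monI).
  - exact: ideal_gen_ideal.
  - by apply: ideal_gen_mem; exists f'.
  - by rewrite mcoeff_msupp mcoeff_initf ?f'alpha ?oner_neq0.
have [||u u1 Wu] := separating_cV _ _ nW.
- by exists 0; rewrite ?vec0.
- move=> c _ _ [f If ->] [g Ig ->]; exists (c *: f + g); last by rewrite vecP.
  by apply: ID => //; apply: ideal_scale.
exists (fun m => (vec 'X_[m] *m u) 0 0); split=> // [f If|m ne_m le_m].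
  have -> : linext (fun m => (vec 'X_[m] *m u) 0 0 : K^o) f = (vec f *m u) 0 0.
    elim/mpolyind: f {If} => [|c m f _ _ IH].
      by rewrite linear0 vec0 mul0mx mxE.
    rewrite linearP /= linextX IH vecP mulmxDl -scalemxAl.
    by rewrite [RHS]mxE [X in _ = X + _]mxE.
  by rewrite Wu ?mxE //; exists f.
have -> : vec 'X_[m] = 0; last by rewrite mul0mx mxE.
apply/rowP => i; rewrite !mxE mcoeffX; case: ifP => // Ui.
case: eqP => // mi; move: Ui; rewrite /U -mi (negbTE ne_m) ltNge le_m.
by rewrite andbF.
Qed.

(** * The x-part and the y-part of a monomial of K[x,y] *)

Lemma mnsub_ext (V W : finType) (mu mu' : V -> 'X_{1..#|W|})
  (m : 'X_{1..#|V|}) : mu =1 mu' -> mnsub mu m = mnsub mu' m.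
Proof. by move=> e; apply: eq_bigr => i _; rewrite e. Qed.

Lemma mnsub_comp (U V W : finType) (mu : V -> 'X_{1..#|W|})
  (mu' : U -> 'X_{1..#|V|}) (m : 'X_{1..#|U|}) :
  mnsub mu (mnsub mu' m) = mnsub (fun u => mnsub mu (mu' u)) m.
Proof.
rewrite [mnsub mu' m]/mnsub (big_morph _ (mnsubD mu) (mnsub0 mu)).
apply: eq_bigr => i _; elim: (m i) => [|k IH]; first by rewrite !mulm0n mnsub0.
by rewrite !mulmS mnsubD IH.
Qed.

Lemma mnsub_id (V : finType) (m : 'X_{1..#|V|}) :
  mnsub (fun v => U_(enum_rank v)%MM) m = m.
Proof.
by rewrite [RHS]multinomUE_id; apply: eq_bigr => i _; rewrite enum_valK.
Qed.

Lemma mnsub_const0 (V W : finType) (m : 'X_{1..#|V|}) :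
  mnsub (fun=> 0%MM : 'X_{1..#|W|}) m = 0%MM.
Proof.
apply: big1 => i _; elim: (m i) => [|k IH]; first by rewrite mulm0n.
by rewrite mulmS IH addm0.
Qed.

Lemma mnsub_addl (V W : finType) (mu mu' : V -> 'X_{1..#|W|})
  (m : 'X_{1..#|V|}) :
  mnsub (fun v => (mu v + mu' v)%MM) m = (mnsub mu m + mnsub mu' m)%MM.
Proof.
rewrite /mnsub -big_split; apply: eq_bigr => i _; apply/mnmP => k.
by rewrite !(mnmDE, mulmnE) mulnDl.
Qed.

Definition xmono (r : nat) (s t : 'I_r -> nat) (v : Vars s) :
  'X_{1..#|XY s t|} := U_(enum_rank (inl v : XY s t))%MM.

Definition ymono (r : nat) (s t : 'I_r -> nat) (u : Vars t) :
  'X_{1..#|XY s t|} := U_(enum_rank (inr u : XY s t))%MM.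

(** Projecting an exponent is itself a monomial substitution, with the y-variables set to one, so
    its properties reduce to composition of [mnsub]. *)
Definition xpart (r : nat) (s t : 'I_r -> nat) (m : 'X_{1..#|XY s t|}) :
  'X_{1..#|Vars s|} :=
  mnsub (fun x : XY s t => if x is inl v then U_(enum_rank v)%MM else 0%MM) m.

Definition ypart (r : nat) (s t : 'I_r -> nat) (m : 'X_{1..#|XY s t|}) :
  'X_{1..#|Vars t|} :=
  mnsub (fun x : XY s t => if x is inr u then U_(enum_rank u)%MM else 0%MM) m.

Lemma xpart_x (r : nat) (s t : 'I_r -> nat) (m : 'X_{1..#|Vars s|}) :
  xpart (mnsub (@xmono r s t) m) = m.
Proof.
by rewrite /xpart mnsub_comp -[RHS]mnsub_id; apply: mnsub_ext => v; rewrite mnsubU.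
Qed.

Lemma xpart_y (r : nat) (s t : 'I_r -> nat) (m : 'X_{1..#|Vars t|}) :
  xpart (mnsub (@ymono r s t) m) = 0%MM.
Proof.
rewrite /xpart mnsub_comp -[RHS](mnsub_const0 _ m).
by apply: mnsub_ext => v; rewrite mnsubU.
Qed.

Lemma ypart_x (r : nat) (s t : 'I_r -> nat) (m : 'X_{1..#|Vars s|}) :
  ypart (mnsub (@xmono r s t) m) = 0%MM.
Proof.
rewrite /ypart mnsub_comp -[RHS](mnsub_const0 _ m).
by apply: mnsub_ext => v; rewrite mnsubU.
Qed.

Lemma ypart_y (r : nat) (s t : 'I_r -> nat) (m : 'X_{1..#|Vars t|}) :
  ypart (mnsub (@ymono r s t) m) = m.
Proof.
by rewrite /ypart mnsub_comp -[RHS]mnsub_id; apply: mnsub_ext => v; rewrite mnsubU.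
Qed.

Lemma xpartD (r : nat) (s t : 'I_r -> nat) (m k : 'X_{1..#|XY s t|}) :
  xpart (m + k)%MM = (xpart m + xpart k)%MM.
Proof. exact: mnsubD. Qed.

Lemma ypartD (r : nat) (s t : 'I_r -> nat) (m k : 'X_{1..#|XY s t|}) :
  ypart (m + k)%MM = (ypart m + ypart k)%MM.
Proof. exact: mnsubD. Qed.

Lemma xyparts (r : nat) (s t : 'I_r -> nat) (m : 'X_{1..#|XY s t|}) :
  m = (mnsub (@xmono r s t) (xpart m) + mnsub (@ymono r s t) (ypart m))%MM.
Proof.
rewrite /xpart /ypart !mnsub_comp -mnsub_addl -[LHS]mnsub_id.
by apply: mnsub_ext => -[v|u]; rewrite !(mnsubU, mnsub0) ?addm0 ?add0m.
Qed.

Lemma incl_xX (K : fieldType) (r : nat) (s t : 'I_r -> nat)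
  (m : 'X_{1..#|Vars s|}) :
  incl_x t ('X_[m] : kpoly K _) = 'X_[mnsub (@xmono r s t) m].
Proof. exact: psubX. Qed.

Lemma incl_yX (K : fieldType) (r : nat) (s t : 'I_r -> nat)
  (m : 'X_{1..#|Vars t|}) :
  incl_y s ('X_[m] : kpoly K _) = 'X_[mnsub (@ymono r s t) m].
Proof. exact: psubX. Qed.

(** * The concatenated weight and the top monomials of I + J *)

Definition sumw (R : realFieldType) (r : nat) (s t : 'I_r -> nat)
  (w1 : Vars s -> R) (w2 : Vars t -> R) (x : XY s t) : R :=
  match x with inl v => w1 v | inr u => w2 u end.

Lemma wt_sumw (R : realFieldType) (r : nat) (s t : 'I_r -> nat)
  (w1 : Vars s -> R) (w2 : Vars t -> R) (m : 'X_{1..#|XY s t|}) :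
  wt (sumw w1 w2) m = wt w1 (xpart m) + wt w2 (ypart m).
Proof.
rewrite {1}[m]xyparts wtD.
by congr (_ + _); rewrite [LHS]wt_mnsub; apply: wt_ext => v; rewrite [LHS]wtU.
Qed.

(** Membership of [h] in the toric fiber product unfolds to membership of [phiB h] in this ideal. *)
Definition sum_ideal (K : fieldType) (r : nat) (s t : 'I_r -> nat)
  (I : kpoly K (Vars s) -> Prop) (J : kpoly K (Vars t) -> Prop) :
  kpoly K (XY s t) -> Prop :=
  ideal_gen (fun q => (exists p, I p /\ q = incl_x t p) \/
                      (exists p, J p /\ q = incl_y s p)).

(** The tensor product of two functionals factors on a monomial multiple of an element of K[x]. It
    therefore vanishes there once [c1] kills [I]. *)
Lemma linext_incl_x (K : fieldType) (r : nat) (s t : 'I_r -> nat)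
  (c1 : 'X_{1..#|Vars s|} -> K^o) (c2 : 'X_{1..#|Vars t|} -> K^o)
  (m : 'X_{1..#|XY s t|}) (f : kpoly K (Vars s)) :
  linext (fun k : 'X_{1..#|XY s t|} => c1 (xpart k) * c2 (ypart k) : K^o)
    ('X_[m] * incl_x t f) = linext c1 ('X_[xpart m] * f) * c2 (ypart m).
Proof.
rewrite [f]mpolyE /incl_x linear_sum /= !mulr_sumr !linear_sum mulr_suml.
apply: eq_bigr => k _; rewrite linearZ -!scalerAr !linearZ /= -scalerAl.
congr (_ *: _); rewrite -/(incl_x t _) incl_xX -!mpolyXD !linextX.
by rewrite xpartD ypartD xpart_x ypart_x addm0.
Qed.

Lemma linext_incl_y (K : fieldType) (r : nat) (s t : 'I_r -> nat)
  (c1 : 'X_{1..#|Vars s|} -> K^o) (c2 : 'X_{1..#|Vars t|} -> K^o)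
  (m : 'X_{1..#|XY s t|}) (g : kpoly K (Vars t)) :
  linext (fun k : 'X_{1..#|XY s t|} => c1 (xpart k) * c2 (ypart k) : K^o)
    ('X_[m] * incl_y s g) = linext c2 ('X_[ypart m] * g) * c1 (xpart m).
Proof.
rewrite [g]mpolyE /incl_y linear_sum /= !mulr_sumr !linear_sum mulr_suml.
apply: eq_bigr => k _; rewrite linearZ -!scalerAr !linearZ /= -scalerAl.
congr (_ *: _); rewrite -/(incl_y s _) incl_yX -!mpolyXD !linextX.
by rewrite xpartD ypartD xpart_y ypart_y addm0 mulrC.
Qed.

Lemma initial_sum_ideal (K : fieldType) (R : realFieldType)
  (r d : nat) (s t : 'I_r -> nat) (a : 'I_r -> 'rV[int]_d) (omega : 'rV[rat]_d)
  (I : kpoly K (Vars s) -> Prop) (J : kpoly K (Vars t) -> Prop)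
  (w1 : Vars s -> R) (w2 : Vars t -> R) (p : kpoly K (XY s t))
  (m : 'X_{1..#|XY s t|}) :
  (forall i, \sum_(l < d) omega 0 l * ((a i 0 l)%:~R : rat) = 1) ->
  homog_ideal a I -> homog_ideal a J ->
  monomial_ideal (initial_ideal w1 I) -> monomial_ideal (initial_ideal w2 J) ->
  sum_ideal I J p -> m \in msupp p ->
  {in msupp p, forall k, wt (sumw w1 w2) k <= wt (sumw w1 w2) m} ->
  initial_ideal w1 I 'X_[xpart m] \/ initial_ideal w2 J 'X_[ypart m].
Proof.
move=> omega1 homI homJ monI monJ Sp mp top; apply: NNPP => /not_or_and[nI nJ].
have [c1 [c1I c1m c1_0]] := separating_functional omega1 homI monI nI.
have [c2 [c2J c2m c2_0]] := separating_functional omega1 homJ monJ nJ.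
pose c (k : 'X_{1..#|XY s t|}) := c1 (xpart k) * c2 (ypart k) : K^o.
have : linext c p = 0.
  move: p Sp {mp top}; apply: ideal_gen_ind => [|p q cp cq|b p cp|k q].
  - exact: linear0.
  - by rewrite linearD /= cp cq addr0.
  - by rewrite linearZ /= cp scaler0.
  - have [[_ _ IM] _] := homI; have [[_ _ JM] _] := homJ.
    move=> [[f [If ->]]|[g [Jg ->]]].
      by rewrite linext_incl_x c1I ?mul0r //; apply: IM.
    by rewrite linext_incl_y c2J ?mul0r //; apply: JM.
(* The term of [p] at [m] is the only one that [c] does not kill, so its coefficient would have to
   be zero. *)
rewrite /linext (bigD1_seq m) ?msupp_uniq //= big_seq_cond big1.
  rewrite addr0 /c c1m c2m mulr1 => /eqP.
  by rewrite scaler_eq0 oner_eq0 orbF; apply/negP; rewrite -mcoeff_msupp.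
move=> k /andP[/top]; rewrite !wt_sumw => le_k ne_km.
suff -> : c k = 0 by rewrite scaler0.
(* Since [k] is no heavier than [m] in total, one of its two parts differs from the corresponding
   part of [m] and is no heavier than it; the functional for that part vanishes there. *)
rewrite /c; have [e1|ne1] := eqVneq (xpart k) (xpart m).
  rewrite [c2 _]c2_0 ?mulr0 //; last by move: le_k; rewrite e1 lerD2l.
  by apply: contra ne_km => /eqP e2; rewrite [k]xyparts [m]xyparts e1 e2.
have [le1|lt1] := lerP (wt w1 (xpart k)) (wt w1 (xpart m)).
  by rewrite [c1 _]c1_0 ?mul0r.
have lt2 : wt w2 (ypart k) < wt w2 (ypart m) by lra.
rewrite [c2 _]c2_0 ?mulr0 ?(ltW lt2) //.
by apply: contraTneq lt2 => ->; rewrite ltxx.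
Qed.

(** * The kernel of phi_B is generated by the quadrics *)

Lemma mnm_split (V : finType) (m : 'X_{1..#|V|}) (v : V) :
  m (enum_rank v) != 0%N -> exists k, m = (U_(enum_rank v) + k)%MM.
Proof.
rewrite -lep1mP => le_vm; exists (m - U_(enum_rank v))%MM.
by rewrite addmC submK.
Qed.

Lemma mnm_neq0_split (V : finType) (m : 'X_{1..#|V|}) : m != 0%MM ->
  exists v k, m = (U_(enum_rank v) + k)%MM.
Proof.
move=> nz; have [i mi] : exists i, m i != 0%N.
  apply/existsP; apply: contraNT nz => /existsPn/= z.
  by apply/eqP/mnmP => i; rewrite mnm0E; apply/eqP; have := z i; rewrite negbK.
exists (enum_val i); apply: mnm_split; by rewrite enum_valK.
Qed.

Lemma mnsub_neq0 (V W : finType) (mu : V -> 'X_{1..#|W|}) (m : 'X_{1..#|V|})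
  (j : 'I_#|W|) : mnsub mu m j != 0%N ->
  exists2 v, mu v j != 0%N & m (enum_rank v) != 0%N.
Proof.
rewrite /mnsub mnm_sumE => nz.
have [i] : exists i, (mu (enum_val i) *+ m i)%MM j != 0%N.
  apply/existsP; apply: contraNT nz => /existsPn/= z.
  by rewrite big1 // => i _; apply/eqP; have := z i; rewrite negbK.
rewrite mulmnE muln_eq0 negb_or => /andP[mu_j mi].
by exists (enum_val i); rewrite ?enum_valK.
Qed.

(** The column of the exponent matrix B at [z]. *)
Definition zmono (r : nat) (s t : 'I_r -> nat) (z : Zvars s t) :
  'X_{1..#|XY s t|} := (xmono t (val z).1 + ymono s (val z).2)%MM.

Lemma phiBE (K : fieldType) (r : nat) (s t : 'I_r -> nat) (z : Zvars s t) :
  @var K (XY s t) (inl (val z).1) * @var K (XY s t) (inr (val z).2) =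
  'X_[zmono z].
Proof. by rewrite mpolyXD. Qed.

Lemma phiBX (K : fieldType) (r : nat) (s t : 'I_r -> nat)
  (m : 'X_{1..#|Zvars s t|}) :
  phiB ('X_[m] : kpoly K _) = 'X_[mnsub (@zmono r s t) m].
Proof. by apply: psubX => z; apply: phiBE. Qed.

Lemma zpair_val (K : fieldType) (r : nat) (s t : 'I_r -> nat) (z : Zvars s t) :
  zpair K (val z) = 'X_[U_(enum_rank z)].
Proof. by rewrite /zpair valK. Qed.

Lemma zpairE (r : nat) (s t : 'I_r -> nat) (v : Vars s) (u : Vars t) :
  tag v = tag u -> exists2 z : Zvars s t, val z = (v, u) &
  forall K : fieldType, zpair K (v, u) = 'X_[U_(enum_rank z)].
Proof.
move=> /eqP e; exists (Sub (v, u) e); first exact: SubK.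
by move=> K; rewrite -zpair_val SubK.
Qed.

Lemma tagged_inj (r : nat) (s : 'I_r -> nat) (v1 v2 : Vars s) :
  tag v1 = tag v2 -> tagged v1 = tagged v2 :> nat -> v1 = v2.
Proof.
case: v1 v2 => [i j] [i' j'] /= e; case: i' / e j' => j' /val_inj /= e.
by congr existT.
Qed.

(** [QuadB] orders both index pairs strictly. Swapping one pair changes the sign, swapping both
    changes nothing, and an equal pair gives zero. *)
Lemma quad_mem (K : fieldType) (r : nat) (s t : 'I_r -> nat)
  (v1 v2 : Vars s) (u1 u2 : Vars t) :
  tag v2 = tag v1 -> tag u1 = tag v1 -> tag u2 = tag v1 ->
  ideal_gen (@QuadB K r s t) (zpair K (v1, u2) * zpair K (v2, u1)
                     - zpair K (v1, u1) * zpair K (v2, u2)).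
Proof.
have idQ := ideal_gen_ideal (@QuadB K r s t); have [Q0 _ _] := idQ.
move=> ev e1 e2.
have QN p q : ideal_gen (@QuadB K r s t) (q - p) -> ideal_gen (@QuadB K r s t) (p - q).
  by move=> Qqp; rewrite -opprB -scaleN1r; apply: ideal_scale.
have [lt_v|lt_v|eq_v] := ltngtP (tagged v1) (tagged v2); last first.
- by rewrite (tagged_inj (esym ev) eq_v) [X in _ - X]mulrC subrr.
- have [lt_u|lt_u|eq_u] := ltngtP (tagged u1) (tagged u2); last first.
  + by rewrite (tagged_inj (etrans e1 (esym e2)) eq_u) subrr.
  + apply: ideal_gen_mem; exists v2, v1, u2, u1.
    by split; [split=> //; congruence | congr (_ - _); rewrite mulrC].
  apply/QN/ideal_gen_mem; exists v2, v1, u1, u2.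
  by split; [split=> //; congruence | congr (_ - _); rewrite mulrC].
have [lt_u|lt_u|eq_u] := ltngtP (tagged u1) (tagged u2); last first.
- by rewrite (tagged_inj (etrans e1 (esym e2)) eq_u) subrr.
- by apply/QN/ideal_gen_mem; exists v1, v2, u2, u1.
by apply: ideal_gen_mem; exists v1, v2, u1, u2.
Qed.

Lemma zmono_eq (r : nat) (s t : 'I_r -> nat) (z z' : Zvars s t) :
  (val z).1 = (val z').1 -> (val z).2 = (val z').2 -> z = z'.
Proof.
move=> e1 e2; apply: val_inj.
by rewrite [LHS]surjective_pairing [RHS]surjective_pairing e1 e2.
Qed.

Lemma zmono_x (r : nat) (s t : 'I_r -> nat) (z : Zvars s t) (v : Vars s) :
  zmono z (enum_rank (inl v : XY s t)) = ((val z).1 == v).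
Proof. by rewrite mnmDE !mnm1E !(inj_eq enum_rank_inj) addn0. Qed.

Lemma zmono_y (r : nat) (s t : 'I_r -> nat) (z : Zvars s t) (u : Vars t) :
  zmono z (enum_rank (inr u : XY s t)) = ((val z).2 == u).
Proof. by rewrite mnmDE !mnm1E !(inj_eq enum_rank_inj) add0n. Qed.

(* One quadric exchange makes the two monomials share a variable, which is then
   cancelled. *)
Lemma quad_congr (K : fieldType) (r : nat) (s t : 'I_r -> nat)
  (m m' : 'X_{1..#|Zvars s t|}) :
  mnsub (@zmono r s t) m = mnsub (@zmono r s t) m' ->
  ideal_gen (@QuadB K r s t) ('X_[m] - 'X_[m']).
Proof.
have [Q0 QD QM] := ideal_gen_ideal (@QuadB K r s t).
have [n le_n] := ubnP (mdeg m); elim: n => // n IH in m m' le_n *.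
have [->|/mnm_neq0_split[z [k mE]]] := eqVneq m 0%MM.
  have [->|/mnm_neq0_split[z [k ->]]] := eqVneq m' 0%MM; first by rewrite subrr.
  rewrite mnsub0 mnsubD mnsubU => /esym/eqP; rewrite /zmono !mnmD_eq0.
  by rewrite mnm1_eq0.
rewrite {m}mE mdegD mdeg1 add1n ltnS in le_n *; rewrite mnsubD mnsubU => e.
(* The x-factor of [z] sits in some variable [z1] of the second monomial. If [z1] is not [z], then
   the y-factor of [z] sits in a further variable [z2]. *)
have : mnsub (@zmono r s t) m' (enum_rank (inl (val z).1 : XY s t)) != 0%N.
  by rewrite -e mnmDE zmono_x eqxx.
move=> /mnsub_neq0[z1]; rewrite zmono_x eqb0 negbK => /eqP z1x /mnm_split[k1 m'E].
rewrite {m'}m'E mnsubD mnsubU in e *.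
have [z1y|z1y] := eqVneq (val z1).2 (val z).2.
  move: e; rewrite (zmono_eq z1x z1y) => /addmI e.
  by rewrite !mpolyXD -mulrBr; apply/QM/IH.
have : mnsub (@zmono r s t) k1 (enum_rank (inr (val z).2 : XY s t)) != 0%N.
  have := congr1 (fun k : 'X_{1..#|XY s t|} => k (enum_rank (inr (val z).2 : XY s t))) e.
  by rewrite /= [LHS]mnmDE [RHS]mnmDE !zmono_y (negbTE z1y) eqxx add0n => <-.
move=> /mnsub_neq0[z2]; rewrite zmono_y eqb0 negbK => /eqP z2y /mnm_split[k2 k1E].
rewrite {k1}k1E mnsubD mnsubU in e *.
have tz (y : Zvars s t) : tag (val y).1 = tag (val y).2 by apply/eqP/(valP y).
have e3 : tag (val z2).1 = tag (val z1).2 by rewrite tz z2y -tz -z1x tz.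
(* [z3] pairs the factors of [z1] and [z2] that [z] leaves over, so trading [z1 z2] for [z z3] is
   one quadric exchange. *)
have [z3 z3E _] := zpairE e3.
have Q3 : ideal_gen (@QuadB K r s t)
    ('X_[U_(enum_rank z1)] * 'X_[U_(enum_rank z2)]
     - 'X_[U_(enum_rank z)] * 'X_[U_(enum_rank z3)]).
  have := @quad_mem K r s t (val z).1 (val z2).1 (val z).2 (val z1).2.
  have -> : ((val z).1, (val z1).2) = val z1 by rewrite -z1x -surjective_pairing.
  have -> : ((val z2).1, (val z).2) = val z2 by rewrite -z2y -surjective_pairing.
  rewrite -surjective_pairing -z3E !zpair_val; apply.
  - by rewrite tz z2y tz.
  - by rewrite tz.
  - by rewrite -z1x tz.
have e' : mnsub (@zmono r s t) k = mnsub (@zmono r s t) (U_(enum_rank z3) + k2)%MM.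
  have ez : (zmono z1 + zmono z2 = zmono z + zmono z3)%MM.
    rewrite /zmono z3E z1x z2y [LHS]Monoid.mulmACA [RHS]Monoid.mulmACA.
    by congr (_ + _)%MM; apply: addmC.
  by apply: (@addmI _ (zmono z)); rewrite e mnsubD mnsubU [LHS]addmA [RHS]addmA ez.
have -> : 'X_[(U_(enum_rank z) + k)%MM]
    - 'X_[(U_(enum_rank z1) + (U_(enum_rank z2) + k2))%MM] =
  'X_[U_(enum_rank z)] * ('X_[k] - 'X_[(U_(enum_rank z3) + k2)%MM])
  + - 'X_[k2] * ('X_[U_(enum_rank z1)] * 'X_[U_(enum_rank z2)]
     - 'X_[U_(enum_rank z)] * 'X_[U_(enum_rank z3)]) :> kpoly K (Zvars s t).
  rewrite !mpolyXD; ring.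
by apply: QD; [apply/QM/IH | apply: QM].
Qed.

(** [tau] picks one preimage of every monomial in the image. Replacing each monomial of [h] by the
    one picked for its image changes [h] only modulo the quadrics. The outcome depends linearly on
    [phiB h] alone, so it is zero. *)
Lemma phiB_ker (K : fieldType) (r : nat) (s t : 'I_r -> nat)
  (h : kpoly K (Zvars s t)) : phiB h = 0 -> ideal_gen (@QuadB K r s t) h.
Proof.
pose tau (k : 'X_{1..#|XY s t|}) : 'X_{1..#|Zvars s t|} :=
  epsilon (inhabits 0%MM) (fun m => mnsub (@zmono r s t) m = k).
have tauE m : mnsub (@zmono r s t) (tau (mnsub (@zmono r s t) m)) =
    mnsub (@zmono r s t) m.
  by apply: (epsilon_spec (inhabits 0%MM) (fun k => mnsub _ k = _)); exists m.
move=> h0; have idQ := ideal_gen_ideal (@QuadB K r s t).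
have E : \sum_(m <- msupp h) h@_m *: 'X_[tau (mnsub (@zmono r s t) m)] = 0
    :> kpoly K (Zvars s t).
  rewrite -[RHS](linear0 (linext (fun k => 'X_[tau k] : kpoly K (Zvars s t)))).
  have -> : 0 = \sum_(m <- msupp h) h@_m *: 'X_[mnsub (@zmono r s t) m]
      :> kpoly K (XY s t).
    apply: etrans (esym h0) _.
    rewrite [h in LHS]mpolyE /phiB linear_sum; apply: eq_bigr => m _.
    by rewrite linearZ -phiBX.
  by rewrite linear_sum; apply: eq_bigr => m _; rewrite linearZ /= linextX.
rewrite -[h]subr0 -E {1}[h]mpolyE -sumrB; apply: ideal_sum => // m _.
by rewrite -scalerBr; apply: ideal_scale => //; apply: quad_congr; rewrite tauE.
Qed.

(** * Words in the variables and the image of phi_B *)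

Definition wmono (V : finType) (l : seq V) : 'X_{1..#|V|} :=
  (\sum_(v <- l) U_(enum_rank v))%MM.

Lemma wmono_cons (V : finType) (v : V) (l : seq V) :
  wmono (v :: l) = (U_(enum_rank v) + wmono l)%MM.
Proof. exact: big_cons. Qed.

Lemma prod_var (K : fieldType) (V : finType) (l : seq V) :
  \prod_(v <- l) @var K V v = 'X_[wmono l].
Proof. by rewrite /var mprodXE. Qed.

Lemma wmono_surj (V : finType) (m : 'X_{1..#|V|}) : exists l, m = wmono l.
Proof.
have [n le_n] := ubnP (mdeg m); elim: n => // n IH in m le_n *.
have [->|/mnm_neq0_split[v [k mE]]] := eqVneq m 0%MM.
  by exists [::]; rewrite /wmono big_nil.
rewrite {m}mE mdegD mdeg1 add1n ltnS in le_n *.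
by have [l ->] := IH k le_n; exists (v :: l); rewrite wmono_cons.
Qed.

(** Used as a weight, this counts the factors of a monomial with upper index [i], so the lemmas on
    [wt] apply to the count. *)
Definition tagw (r : nat) (s : 'I_r -> nat) (i : 'I_r) (v : Vars s) : rat :=
  (tag v == i)%:R.

Lemma wt_wmono (r : nat) (s : 'I_r -> nat) (i : 'I_r) (l : seq (Vars s)) :
  wt (tagw i) (wmono l) = (count_mem i (map tag l))%:R.
Proof.
elim: l => [|v l IH]; first by rewrite /wmono big_nil wt0.
by rewrite wmono_cons wtD wtU IH /= natrD.
Qed.

Lemma wt_tagw_ge0 (r : nat) (s : 'I_r -> nat) (i : 'I_r)
  (m : 'X_{1..#|Vars s|}) : 0 <= wt (tagw i) m.
Proof. by apply: sumr_ge0 => v _; rewrite mulr_ge0 ?ler0n. Qed.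

Lemma wt_tagw_eq0 (r : nat) (s : 'I_r -> nat) (m : 'X_{1..#|Vars s|}) :
  (forall i, wt (tagw i) m = 0) -> m = 0%MM.
Proof.
move=> m0; apply/eqP/negPn/negP => /mnm_neq0_split[v [k mE]].
have t1 : tagw (tag v) v = 1 by rewrite /tagw eqxx.
have := m0 (tag v); have := wt_tagw_ge0 (tag v) k.
by rewrite mE wtD wtU t1; lra.
Qed.

(** The word is taken out letter by letter: a positive count for [i] provides a variable with that
    upper index, and dividing by it lowers both sides of the inequality equally. *)
Lemma word_extract (r : nat) (s : 'I_r -> nat) (ii : seq 'I_r)
  (m : 'X_{1..#|Vars s|}) :
  (forall i, (count_mem i ii)%:R <= wt (tagw i) m) ->
  exists l k, map tag l = ii /\ m = (wmono l + k)%MM.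
Proof.
elim: ii m => [|i ii IH] m le_m.
  by exists [::], m; split; rewrite // /wmono big_nil add0m.
have /exists_inP[v /eqP tv mv] :
    [exists (v : Vars s | tag v == i), m (enum_rank v) != 0%N].
  apply: contraT => /exists_inPn/= nex.
  have := le_m i; rewrite /= eqxx leNgt /wt big1 ?ltr0n // => v _.
  rewrite /tagw; case: (boolP (tag v == i)) => [/nex|_]; last by rewrite mul0r.
  by rewrite negbK => /eqP ->; rewrite mulr0.
have [k mE] := mnm_split mv.
have [j|l [k' [ltag kE]]] := IH k.
  by have := le_m j; rewrite mE wtD wtU /tagw tv /= natrD lerD2l.
by exists (v :: l), k'; rewrite /= tv ltag mE kE wmono_cons addmA.
Qed.

(** Equal index sequences make every pair of letters a genuine variable, so no factor falls to the
    default value 0 of [zpair]. *)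
Lemma zip_zpair (r : nat) (s t : 'I_r -> nat) (xs : seq (Vars s))
  (ys : seq (Vars t)) : map tag xs = map tag ys ->
  exists2 m : 'X_{1..#|Zvars s t|},
    mnsub (@zmono r s t) m =
      (mnsub (@xmono r s t) (wmono xs) + mnsub (@ymono r s t) (wmono ys))%MM
    & forall K : fieldType, \prod_(pr <- zip xs ys) zpair K pr = 'X_[m].
Proof.
elim: xs ys => [|v xs IH] [|u ys] //=.
  by exists 0%MM => [|K]; rewrite ?big_nil ?mpolyX0 // /wmono !big_nil !mnsub0 addm0.
move=> [/zpairE[z zE zpE] /IH[m mE mpE]]; exists (U_(enum_rank z) + m)%MM.
  by rewrite !wmono_cons !mnsubD !mnsubU mE /zmono zE [LHS]Monoid.mulmACA.
by move=> K; rewrite big_cons zpE mpE mpolyXD.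
Qed.

(** The exponents of this kind form the semigroup generated by the columns of B. *)
Definition balanced (r : nat) (s t : 'I_r -> nat) (m : 'X_{1..#|XY s t|}) :=
  [forall i, wt (tagw i) (xpart m) == wt (tagw i) (ypart m)].

Lemma balanced_mono (r : nat) (s t : 'I_r -> nat) (mx : 'X_{1..#|Vars s|})
  (my : 'X_{1..#|Vars t|}) :
  balanced (mnsub (@xmono r s t) mx + mnsub (@ymono r s t) my)%MM =
  [forall i, wt (tagw i) mx == wt (tagw i) my].
Proof.
by rewrite /balanced xpartD ypartD xpart_x xpart_y ypart_x ypart_y addm0 add0m.
Qed.

(** Balance lets a word with the index sequence of the x-part be taken out of the y-part. The counts
    leave no remainder, and the two words zip to a monomial in the z-variables. *)
Lemma balanced_image (r : nat) (s t : 'I_r -> nat) (m : 'X_{1..#|XY s t|}) :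
  balanced m <-> exists k, m = mnsub (@zmono r s t) k.
Proof.
split=> [/forallP/= bal|[k ->]].
  have [xs xsE] := wmono_surj (xpart m).
  have [i|ys [k [tys ysE]]] := @word_extract _ t (map tag xs) (ypart m).
    by rewrite -wt_wmono -xsE (eqP (bal i)).
  have k0 : k = 0%MM.
    apply: wt_tagw_eq0 => i; have := eqP (bal i).
    by rewrite xsE ysE wtD !wt_wmono tys; lra.
  have [k' k'E _] := zip_zpair (esym tys); exists k'.
  by rewrite [m]xyparts xsE ysE k0 addm0 k'E.
apply/forallP => i /=; apply/eqP; rewrite /xpart /ypart !mnsub_comp !wt_mnsub.
apply: wt_ext => z; rewrite /zmono !mnsubD !mnsubU addm0 add0m !wtU.
by rewrite /tagw (eqP (valP z)).
Qed.

(** * Lifts and their initial forms *)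

Lemma pullback_weightE (R : realFieldType) (r : nat) (s t : 'I_r -> nat)
  (w1 : Vars s -> R) (w2 : Vars t -> R) (m : 'X_{1..#|Zvars s t|}) :
  wt (pullback_weight w1 w2) m = wt (sumw w1 w2) (mnsub (@zmono r s t) m).
Proof.
rewrite wt_mnsub; apply: wt_ext => z.
by rewrite wtD [X in _ = X + _]wtU [X in _ = _ + X]wtU.
Qed.

(** The words of a presentation have distinct monomials, so no term cancels. *)
Lemma presentation_msupp (K : fieldType) (r : nat) (s : 'I_r -> nat)
  (f : kpoly K (Vars s)) (ii : seq 'I_r) (ts : seq (K * seq (Vars s)))
  (cw : K * seq (Vars s)) :
  presentation f ii ts -> cw \in ts -> wmono cw.2 \in msupp f.
Proof.
move=> [nz uniq_ts ->] cw_ts; have [cw_nz _] := nz _ cw_ts.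
move: uniq_ts; rewrite (perm_uniq (perm_map _ (perm_to_rem cw_ts))) /=.
move=> /andP[/mapP nin _]; rewrite mcoeff_msupp (perm_big _ (perm_to_rem cw_ts)).
rewrite big_cons prod_var mcoeffD raddf_sum /= big_seq big1 ?addr0 => [|cw' cw'_ts].
  by rewrite mcoeffZ mcoeffX eqxx mulr1.
rewrite mcoeffZ prod_var mcoeffX; case: eqP => [e|]; last by rewrite mulr0.
by case: nin; exists cw'; rewrite // !prod_var e.
Qed.

Lemma mcoeff_psub (K : fieldType) (V W : finType) (h : V -> kpoly K W)
  (mu : V -> 'X_{1..#|W|}) (p : kpoly K V) (m : 'X_{1..#|V|}) :
  (forall v, h v = 'X_[mu v]) -> injective (mnsub mu) ->
  (psub h p)@_(mnsub mu m) = p@_m.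
Proof.
move=> hE mu_inj; rewrite [in LHS](mpolyE p) [in RHS](mpolyE p).
rewrite (linear_sum (psub h)) !raddf_sum; apply: eq_bigr => k _.
by rewrite linearZ /= (psubX _ hE) !mcoeffZ !mcoeffX (inj_eq mu_inj).
Qed.

(** Both kinds of lift are treated at once: [mu] embeds the variables of one factor, [psi] turns a
    word into its z-monomial, and [e] is the fixed monomial from the other factor. The image of the
    lift is [f] times that monomial, so all weights shift by the weight of [e] and the top terms
    correspond. *)
Lemma lift_initf (K : fieldType) (R : realFieldType) (r : nat)
  (q s t : 'I_r -> nat) (mu : Vars q -> 'X_{1..#|XY s t|})
  (h : Vars q -> kpoly K (XY s t)) (w1 : Vars s -> R) (w2 : Vars t -> R)
  (w : Vars q -> R) (f : kpoly K (Vars q)) (ii : seq 'I_r)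
  (ts : seq (K * seq (Vars q))) (e : 'X_{1..#|XY s t|})
  (psi : seq (Vars q) -> kpoly K (Zvars s t)) :
  (forall v, h v = 'X_[mu v]) -> injective (mnsub mu) ->
  (forall v, wt (sumw w1 w2) (mu v) = w v) ->
  presentation f ii ts ->
  (forall xs, map tag xs = ii ->
     exists2 m, mnsub (@zmono r s t) m = (mnsub mu (wmono xs) + e)%MM
              & psi xs = 'X_[m]) ->
  let fe := \sum_(cw <- ts) cw.1 *: psi cw.2 in
  phiB fe = psub h f * 'X_[e] /\
  phiB (initf (pullback_weight w1 w2) fe) = psub h (initf w f) * 'X_[e].
Proof.
move=> hE mu_inj muw pres psiE fe; have [nz _ fE] := pres.
have phi_fe : phiB fe = psub h f * 'X_[e].
  rewrite fE /phiB !linear_sum mulr_suml [LHS]big_seq [RHS]big_seq.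
  apply: eq_bigr => cw /nz[_ /psiE[m mE ->]].
  rewrite !linearZ /= -/(phiB _) phiBX mE prod_var (psubX _ hE).
  by rewrite mpolyXD scalerAl.
split=> //; have [f0|] := eqVneq f 0.
  have ts0 : ts = [::].
    case E: ts => [//|cw l].
    have : cw \in ts by rewrite E mem_head.
    by move=> /(presentation_msupp pres); rewrite f0 msupp0.
  by rewrite /fe ts0 big_nil f0 !initf0 /phiB !linear0 mul0r.
move=> /(msupp_top w)[m0 m0f top].
pose W := wt w m0 + wt (sumw w1 w2) e.
have wtmu m : wt (sumw w1 w2) (mnsub mu m) = wt w m.
  by rewrite wt_mnsub; apply: wt_ext.
have le_W : {in msupp fe, forall m, wt (pullback_weight w1 w2) m <= W}.
  move=> m /msupp_sum_le/flattenP[ms /mapP[cw]]; rewrite mem_filter /= => cw_ts ->.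
  have [_ /psiE[k kE ->]] := nz _ cw_ts.
  move=> /msuppZ_le; rewrite msuppX inE => /eqP ->.
  rewrite pullback_weightE kE wtD wtmu lerD2r; apply: top.
  exact: presentation_msupp pres cw_ts.
(* The bound [W] is attained: the image contains the top monomial of [f] shifted by [e], which must
   come from some monomial of [fe]. *)
have [k kfe kE] : exists2 k, k \in msupp fe &
    (e + mnsub mu m0)%MM = mnsub (@zmono r s t) k.
  apply: (@msupp_psub K _ _ _ _ fe); first exact: phiBE.
  rewrite mcoeff_msupp -/(phiB _) phi_fe mcoeffMX (mcoeff_psub _ _ hE) //.
  by rewrite -mcoeff_msupp.
rewrite (initf_top le_W); last first.
  by exists k => //; rewrite pullback_weightE -kE wtD wtmu addrC.
rewrite (initf_top top); last by exists m0.
rewrite -(mfilt_psub (P := fun m => wt (sumw w1 w2) m == wt w m0) _ hE); last first.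
  by move=> m; rewrite wtmu.
rewrite mulrC -(mfiltXM (P := fun m => wt (sumw w1 w2) m == W)); last first.
  by move=> m; rewrite wtD addrC (inj_eq (addIr _)).
rewrite mulrC -phi_fe; apply/esym/mfilt_psub; first exact: phiBE.
by move=> m; rewrite pullback_weightE.
Qed.

Lemma mfilt_const (K : fieldType) (n : nat) (P : pred 'X_{1..n}) (b : bool)
  (m : 'X_{1..n}) (q : {mpoly K[n]}) :
  {in msupp q, forall k, P (m + k)%MM = b} ->
  mfilt P ('X_[m] * q) = if b then 'X_[m] * q else 0.
Proof.
move=> Pb; rewrite (@mfiltXM _ _ _ (fun k => P (m + k)%MM)) //.
case: b Pb => Pb; first by rewrite mfilt_id // => k /Pb.
by rewrite mfilt_eq0 ?mulr0 // => k /Pb ->.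
Qed.

Lemma wt_initf_presentation (K : fieldType) (R : realFieldType) (r : nat)
  (s : 'I_r -> nat) (w : Vars s -> R) (f : kpoly K (Vars s)) (ii : seq 'I_r)
  (ts : seq (K * seq (Vars s))) (m : 'X_{1..#|Vars s|}) (i : 'I_r) :
  presentation f ii ts -> m \in msupp (initf w f) ->
  wt (tagw i) m = (count_mem i ii)%:R.
Proof.
move=> [nz _ fE]; rewrite msupp_mfilt => /andP[_]; rewrite fE.
move=> /msupp_sum_le/flattenP[ms /mapP[cw]]; rewrite mem_filter /= => /nz[_ <-] ->.
by rewrite prod_var => /msuppZ_le; rewrite msuppX inE => /eqP ->; rewrite wt_wmono.
Qed.

Lemma xmono_inj (r : nat) (s t : 'I_r -> nat) : injective (mnsub (@xmono r s t)).
Proof. exact: can_inj (@xpart_x r s t). Qed.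

Lemma ymono_inj (r : nat) (s t : 'I_r -> nat) : injective (mnsub (@ymono r s t)).
Proof. exact: can_inj (@ypart_y r s t). Qed.

(** The polynomial $f_k$ of the lift, taken for an arbitrary presentation; [lifty] is $g_j$. *)
Definition liftx (K : fieldType) (r : nat) (s t : 'I_r -> nat)
  (ts : seq (K * seq (Vars s))) (k : seq (Vars t)) : kpoly K (Zvars s t) :=
  \sum_(cw <- ts) cw.1 *: \prod_(pr <- zip cw.2 k) zpair K pr.

Definition lifty (K : fieldType) (r : nat) (s t : 'I_r -> nat)
  (ts : seq (K * seq (Vars t))) (j : seq (Vars s)) : kpoly K (Zvars s t) :=
  \sum_(cw <- ts) cw.1 *: \prod_(pr <- zip j cw.2) zpair K pr.

Lemma phiB_liftx (K : fieldType) (R : realFieldType) (r : nat)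
  (s t : 'I_r -> nat) (w1 : Vars s -> R) (w2 : Vars t -> R)
  (f : kpoly K (Vars s)) (ii : seq 'I_r) (ts : seq (K * seq (Vars s)))
  (k : seq (Vars t)) :
  presentation f ii ts -> map tag k = ii ->
  phiB (liftx ts k) = incl_x t f * 'X_[mnsub (@ymono r s t) (wmono k)] /\
  phiB (initf (pullback_weight w1 w2) (liftx ts k)) =
    incl_x t (initf w1 f) * 'X_[mnsub (@ymono r s t) (wmono k)].
Proof.
move=> pres tk.
apply: (lift_initf (mu := @xmono r s t)
  (psi := fun xs => \prod_(pr <- zip xs k) zpair K pr)
  _ (@xmono_inj r s t) _ pres) => //.
  by move=> v; rewrite wtU.
move=> xs txs; have [|m mE mp] := @zip_zpair r s t xs k; first by rewrite tk.
by exists m; [exact: mE | exact: mp].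
Qed.

Lemma phiB_lifty (K : fieldType) (R : realFieldType) (r : nat)
  (s t : 'I_r -> nat) (w1 : Vars s -> R) (w2 : Vars t -> R)
  (g : kpoly K (Vars t)) (ii : seq 'I_r) (ts : seq (K * seq (Vars t)))
  (j : seq (Vars s)) :
  presentation g ii ts -> map tag j = ii ->
  phiB (lifty ts j) = incl_y s g * 'X_[mnsub (@xmono r s t) (wmono j)] /\
  phiB (initf (pullback_weight w1 w2) (lifty ts j)) =
    incl_y s (initf w2 g) * 'X_[mnsub (@xmono r s t) (wmono j)].
Proof.
move=> pres tj.
apply: (lift_initf (mu := @ymono r s t)
  (psi := fun ys => \prod_(pr <- zip j ys) zpair K pr)
  _ (@ymono_inj r s t) _ pres) => //.
  by move=> v; rewrite wtU.
move=> ys tys; have [|m mE mp] := @zip_zpair r s t j ys; first by rewrite tj.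
by exists m; [rewrite mE addmC | exact: mp].
Qed.

(** All monomials of [initf w1 f] have the index counts of [ii], so a monomial multiple is either
    entirely balanced or has no balanced term. In the first case the y-part of [m] has enough
    factors of each index to contain a word [k] for a lift. *)
Lemma balanced_liftx (K : fieldType) (R : realFieldType) (r : nat)
  (s t : 'I_r -> nat) (w1 : Vars s -> R) (w2 : Vars t -> R)
  (f : kpoly K (Vars s)) (ii : seq 'I_r) (ts : seq (K * seq (Vars s)))
  (L : kpoly K (Zvars s t) -> Prop) (m : 'X_{1..#|XY s t|}) :
  is_ideal L -> presentation f ii ts ->
  (forall k, map tag k = ii -> L (initf (pullback_weight w1 w2) (liftx ts k))) ->
  exists2 h, L h &
    phiB h = mfilt (@balanced r s t) ('X_[m] * incl_x t (initf w1 f)).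
Proof.
move=> [L0 _ LM] pres Lk.
rewrite (@mfilt_const _ _ _ [forall i,
  wt (tagw i) (xpart m) + (count_mem i ii)%:R == wt (tagw i) (ypart m)]).
  case: forallP => [/= bal|_]; last by exists 0; rewrite // /phiB linear0.
  have [i|k [y0 [tk yE]]] := @word_extract r t ii (ypart m).
    by rewrite -(eqP (bal i)) lerDr wt_tagw_ge0.
  (* Without the letters of [k], the monomial [m] is balanced by itself, hence the image of a
     cofactor [u]. *)
  have /balanced_image[u uE] :
      balanced (mnsub (@xmono r s t) (xpart m) + mnsub (@ymono r s t) y0)%MM.
    rewrite balanced_mono; apply/forallP => i /=; apply/eqP.
    by have := eqP (bal i); rewrite yE wtD wt_wmono tk; lra.
  exists ('X_[u] * initf (pullback_weight w1 w2) (liftx ts k)); first exact/LM/Lk.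
  have [_ phi_k] := phiB_liftx w1 w2 pres tk.
  rewrite {1}/phiB psubM -!/(phiB _) phiBX phi_k -uE {2}[m]xyparts yE.
  by rewrite mnsubD !mpolyXD; ring.
move=> k /msupp_psub -/(_ (@xmono r s t))[//|k' k'f ->].
rewrite {1}[m]xyparts -addmA [X in (_ + X)%MM]addmC addmA -mnsubD balanced_mono.
apply: eq_forallb => i; rewrite wtD.
by rewrite (wt_initf_presentation i pres k'f).
Qed.

Lemma balanced_lifty (K : fieldType) (R : realFieldType) (r : nat)
  (s t : 'I_r -> nat) (w1 : Vars s -> R) (w2 : Vars t -> R)
  (g : kpoly K (Vars t)) (ii : seq 'I_r) (ts : seq (K * seq (Vars t)))
  (L : kpoly K (Zvars s t) -> Prop) (m : 'X_{1..#|XY s t|}) :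
  is_ideal L -> presentation g ii ts ->
  (forall j, map tag j = ii -> L (initf (pullback_weight w1 w2) (lifty ts j))) ->
  exists2 h, L h &
    phiB h = mfilt (@balanced r s t) ('X_[m] * incl_y s (initf w2 g)).
Proof.
move=> [L0 _ LM] pres Lj.
rewrite (@mfilt_const _ _ _ [forall i,
  wt (tagw i) (xpart m) == wt (tagw i) (ypart m) + (count_mem i ii)%:R]).
  case: forallP => [/= bal|_]; last by exists 0; rewrite // /phiB linear0.
  have [i|j [x0 [tj xE]]] := @word_extract r s ii (xpart m).
    by rewrite (eqP (bal i)) lerDr wt_tagw_ge0.
  have /balanced_image[u uE] :
      balanced (mnsub (@xmono r s t) x0 + mnsub (@ymono r s t) (ypart m))%MM.
    rewrite balanced_mono; apply/forallP => i /=; apply/eqP.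
    by have := eqP (bal i); rewrite xE wtD wt_wmono tj; lra.
  exists ('X_[u] * initf (pullback_weight w1 w2) (lifty ts j)); first exact/LM/Lj.
  have [_ phi_j] := phiB_lifty w1 w2 pres tj.
  rewrite {1}/phiB psubM -!/(phiB _) phiBX phi_j -uE {2}[m]xyparts xE.
  by rewrite mnsubD !mpolyXD; ring.
move=> k /msupp_psub -/(_ (@ymono r s t))[//|k' k'g ->].
rewrite {1}[m]xyparts -addmA -mnsubD balanced_mono.
apply: eq_forallb => i; rewrite wtD.
by rewrite (wt_initf_presentation i pres k'g).
Qed.

(** * From membership in K[x,y] back to K[z] *)

(** Projection to the balanced monomials is linear and fixes [phiB h]. An expression of [phiB h]
    through [T] can thus be projected and lifted into [L] summand by summand; what it misses of [h]
    lies in the kernel of [phiB]. *)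
Lemma phiB_mem (K : fieldType) (r : nat) (s t : 'I_r -> nat)
  (L : kpoly K (Zvars s t) -> Prop) (T : kpoly K (XY s t) -> Prop)
  (h : kpoly K (Zvars s t)) :
  is_ideal L -> (forall q, QuadB q -> L q) ->
  (forall m q, T q ->
     exists2 h', L h' & phiB h' = mfilt (@balanced r s t) ('X_[m] * q)) ->
  ideal_gen T (phiB h) -> L h.
Proof.
move=> idL QL TL Th; have [L0 LD _] := idL.
have [h' Lh' h'E] : exists2 h', L h' & phiB h' = mfilt (@balanced r s t) (phiB h).
  move: (phiB h) Th; apply: ideal_gen_ind => [|p q|c p|//].
  - by exists 0; rewrite // linear0 /phiB linear0.
  - move=> [hp Lp pE] [hq Lq qE]; exists (hp + hq); first exact: LD.
    by rewrite linearD /= -pE -qE /phiB linearD.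
  - move=> [hp Lp pE]; exists (c *: hp); first exact: ideal_scale.
    by rewrite linearZ /= -pE /phiB linearZ.
have phi_bal : mfilt (@balanced r s t) (phiB h) = phiB h.
  apply: mfilt_id => m /msupp_psub -/(_ _ (@phiBE K r s t))[k _ mE].
  by apply/balanced_image; exists k.
rewrite -[h](subrK h'); apply: LD => //.
apply: (ideal_gen_min idL QL); apply: phiB_ker.
by rewrite /phiB linearB /= -!/(phiB _) h'E phi_bal subrr.
Qed.

(** The two monomials of a quadric have the same image under [phiB], hence the same pullback
    weight. *)
Lemma initf_QuadB (K : fieldType) (R : realFieldType) (r : nat)
  (s t : 'I_r -> nat) (w1 : Vars s -> R) (w2 : Vars t -> R)
  (h : kpoly K (Zvars s t)) :
  QuadB h -> initf (pullback_weight w1 w2) h = h.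
Proof.
move=> [v1 [v2 [u1 [u2 [[ev e1 e2 _ _] ->]]]]].
apply: (@initf_homog _ _ _ _ (w1 v1 + w1 v2 + (w2 u1 + w2 u2))) => m.
have [z12 z12E ->] := zpairE (esym e2).
have [z21 z21E ->] := zpairE (etrans ev (esym e1)).
have [z11 z11E ->] := zpairE (esym e1).
have [z22 z22E ->] := zpairE (etrans ev (esym e2)).
rewrite -!mpolyXD => /msuppB_le; rewrite mem_cat !msuppX !inE.
by case/orP => /eqP ->; rewrite wtD !wtU /pullback_weight;
  rewrite ?z12E ?z21E ?z11E ?z22E /=; ring.
Qed.

Lemma phiB_QuadB (K : fieldType) (r : nat) (s t : 'I_r -> nat)
  (h : kpoly K (Zvars s t)) : QuadB h -> phiB h = 0.
Proof.
move=> [v1 [v2 [u1 [u2 [[ev e1 e2 _ _] ->]]]]].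
have [z12 z12E ->] := zpairE (esym e2).
have [z21 z21E ->] := zpairE (etrans ev (esym e1)).
have [z11 z11E ->] := zpairE (esym e1).
have [z22 z22E ->] := zpairE (etrans ev (esym e2)).
rewrite /phiB linearB /= !psubM -!/(phiB _) !phiBX !mnsubU /zmono.
by rewrite z12E z21E z11E z22E /= !mpolyXD; ring.
Qed.

(** The preimage of [T] under the inclusion is an ideal, so checking the generators supplied by [F]
    is enough. *)
Lemma incl_x_initial (K : fieldType) (R : realFieldType) (r : nat)
  (s t : 'I_r -> nat) (w : Vars s -> R) (I : kpoly K (Vars s) -> Prop)
  (F : seq (kpoly K (Vars s))) (T : kpoly K (XY s t) -> Prop)
  (q : kpoly K (Vars s)) :
  pseudo_GB (fun f => f \in F) w I -> is_ideal T ->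
  (forall f, f \in F -> T (incl_x t (initf w f))) ->
  initial_ideal w I q -> T (incl_x t q).
Proof.
move=> [_ inF] [T0 TD TM] TF /inF; move: q.
apply: ideal_gen_min => [|_ [f [fF ->]]]; last exact: TF.
split=> [|p q Tp Tq|p q Tq]; first by rewrite /incl_x linear0.
  by rewrite /incl_x linearD; apply: TD.
by rewrite /incl_x psubM; apply: TM.
Qed.

Lemma incl_y_initial (K : fieldType) (R : realFieldType) (r : nat)
  (s t : 'I_r -> nat) (w : Vars t -> R) (J : kpoly K (Vars t) -> Prop)
  (G : seq (kpoly K (Vars t))) (T : kpoly K (XY s t) -> Prop)
  (q : kpoly K (Vars t)) :
  pseudo_GB (fun g => g \in G) w J -> is_ideal T ->
  (forall g, g \in G -> T (incl_y s (initf w g))) ->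
  initial_ideal w J q -> T (incl_y s q).
Proof.
move=> [_ inG] [T0 TD TM] TG /inG; move: q.
apply: ideal_gen_min => [|_ [g [gG ->]]]; last exact: TG.
split=> [|p q Tp Tq|p q Tq]; first by rewrite /incl_y linear0.
  by rewrite /incl_y linearD; apply: TD.
by rewrite /incl_y psubM; apply: TM.
Qed.

Theorem theorem2p8 (K : fieldType) (R : realFieldType)
  (r : nat) (s t : 'I_r -> nat) (d : nat)
  (a : 'I_r -> 'rV[int]_d) (omega : 'rV[rat]_d)
  (I : kpoly K (Vars s) -> Prop) (J : kpoly K (Vars t) -> Prop)
  (F : seq (kpoly K (Vars s))) (G : seq (kpoly K (Vars t)))
  (w1 : Vars s -> R) (w2 : Vars t -> R)
  (P : kpoly K (Vars s) -> seq 'I_r * seq (K * seq (Vars s)))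
  (Q : kpoly K (Vars t) -> seq 'I_r * seq (K * seq (Vars t))) :
  (0 < r)%N ->
  (forall i, 0 < s i)%N ->
  (forall i, 0 < t i)%N ->
  (forall i, \sum_(l < d) omega 0 l * ((a i 0 l)%:~R : rat) = 1) ->
  homog_ideal a I -> homog_ideal a J ->
  (* A is linearly independent *)
  row_free (\matrix_(i < r, l < d) ((a i 0 l)%:~R : rat)) ->
  (forall f, f \in F -> homogeneous a f) -> GB F w1 I ->
  (forall g, g \in G -> homogeneous a g) -> GB G w2 J ->
  (forall f, f \in F -> presentation f (P f).1 (P f).2) ->
  (forall g, g \in G -> presentation g (Q g).1 (Q g).2) ->
  pseudo_GB (fun h : kpoly K (Zvars s t) =>
               LiftF F P h \/ LiftG G Q h \/ QuadB h)
            (pullback_weight w1 w2) (toric_fiber_product I J).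
Proof.
move=> _ _ _ omega1 homI homJ _ _ [gbF monI] _ [gbG monJ] presF presG.
set lifts := fun h : kpoly K (Zvars s t) => _.
pose pw := pullback_weight w1 w2 : Zvars s t -> R.
pose L := ideal_gen (fun q => exists h, lifts h /\ q = initf pw h).
pose S := sum_ideal I J.
have idL : is_ideal L by apply: ideal_gen_ideal.
have [S0 _ SM] : is_ideal S by apply: ideal_gen_ideal.
(* A lift maps to a monomial multiple of its [f] or [g], and a quadric maps to zero. *)
have lifts_tfp h : lifts h -> toric_fiber_product I J h.
  rewrite /toric_fiber_product; case=> [[f [fF [k [tk ->]]]]|[[g [gG [j [tj ->]]]]|Qh]].
  - have [-> _] := phiB_liftx w1 w2 (presF f fF) tk; rewrite mulrC.
    apply/SM/ideal_gen_mem; left; exists f; split=> //.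
    by have [FI _] := gbF; apply: FI.
  - have [-> _] := phiB_lifty w1 w2 (presG g gG) tj; rewrite mulrC.
    apply/SM/ideal_gen_mem; right; exists g; split=> //.
    by have [GJ _] := gbG; apply: GJ.
  - by rewrite (phiB_QuadB Qh).
split=> // p; split.
  apply: ideal_gen_min; first exact: ideal_gen_ideal.
  move=> _ [h [lh ->]]; apply: ideal_gen_mem; exists h.
  by split; first apply: lifts_tfp.
move: p; apply: ideal_gen_min => // _ [h [Sh ->]].
(* In K[x,y] these initial forms generate in(I) + in(J). *)
pose T q := (exists2 f, f \in F & q = incl_x t (initf w1 f)) \/
            (exists2 g, g \in G & q = incl_y s (initf w2 g)).
have idT := ideal_gen_ideal T; have [_ _ TM] := idT.
apply: (phiB_mem (T := T) idL) => [q Qq|m q|].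
- apply: ideal_gen_mem; exists q; rewrite initf_QuadB //.
  by split=> //; right; right.
- case=> [[f fF ->]|[g gG ->]].
    apply: balanced_liftx idL (presF f fF) _ => k tk.
    apply: ideal_gen_mem; exists (liftx (P f).2 k); split=> //.
    by left; exists f; split=> //; exists k.
  apply: balanced_lifty idL (presG g gG) _ => j tj.
  apply: ideal_gen_mem; exists (lifty (Q g).2 j); split=> //.
  by right; left; exists g; split=> //; exists j.
have [->|/(msupp_top pw)[m0 m0h top]] := eqVneq h 0.
  by rewrite initf0 /phiB linear0; have [T0 _ _] := idT.
rewrite (initf_top top); last by exists m0.
(* The image of the initial form consists of the terms of [phiB h] of weight [wt pw m0]. If they all
   cancel under [phiB], the sum below is empty. *)
rewrite /phiB -(mfilt_psub (P := fun m => wt (sumw w1 w2) m == wt pw m0) _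
  (@phiBE K r s t)); last first.
  by move=> m; rewrite -pullback_weightE.
rewrite -/(phiB h) [mfilt _ _]mpolyE; apply: ideal_sum => // m.
rewrite msupp_mfilt => /andP[/eqP wm mh]; apply: ideal_scale => //.
(* No monomial of [phiB h] is heavier than those of [h], so a surviving [m] has top weight in
   [phiB h]. *)
have topm : {in msupp (phiB h), forall k,
    wt (sumw w1 w2) k <= wt (sumw w1 w2) m}.
  move=> k /msupp_psub -/(_ _ (@phiBE K r s t))[k' k'h ->].
  by rewrite wm -pullback_weightE top.
have [inI|inJ] := initial_sum_ideal omega1 homI homJ monI monJ Sh mh topm.
  rewrite [m]xyparts addmC mpolyXD -incl_xX; apply: TM.
  apply: (incl_x_initial gbF idT _ inI) => f fF.
  by apply: ideal_gen_mem; left; exists f.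
rewrite [m]xyparts mpolyXD -incl_yX; apply: TM.
apply: (incl_y_initial gbG idT _ inJ) => g gG.
by apply: ideal_gen_mem; right; exists g.
Qed.
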